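(* Let $n>2$, let $\Omega=\bigcup_{k=0}^nJ_k$, and let $B\in U(n)$ be non-degenerate, i.e. $1\notin\mathrm{sp}(B')$ where $B'$ is the upper right $(n-1)\times(n-1)$ corner of $B$. Let $d\sigma_B(\lambda)=F_B(\lambda)\,d\lambda$ be the measure on $\mathbb{R}$ occurring in the spectral representation of $U_B(t)$ described in the context, with generalized eigenfunctions $\psi_\lambda^{(B)}$, and let $V_B:L^2(\Omega)\to L^2(\mathbb{R},\sigma_B)$ be the spectral transform $$(V_Bf)(\lambda)=\langle\psi_\lambda^{(B)},f\rangle_\Omega=\int_\Omega\overline{\psi_\lambda^{(B)}(y)}f(y)\,dy,$$ with adjoint operator $V_B^*:L^2(\mathbb{R},\sigma_B)\to L^2(\Omega)$. Then $$V_BV_B^*=I_{L^2(\sigma_B)}\quad\text{and}\quad V_B^*V_B=I_{L^2(\Omega)}.$$ Moreover, $$V_BU_B(t)V_B^*=M_t,$$ where $M_t$ is the unitary one-parameter group acting on $L^2(\mathbb{R},\sigma_B)$ by $(M_tg)(\lambda)=e_\lambda(-t)g(\lambda)$ for all $t,\lambda\in\mathbb{R}$ and all $g\in L^2(\mathbb{R},\sigma_B)$.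
   Context: Notation: $e_\lambda(x)=e^{i2\pi\lambda x}$. Inner products are linear in the second variable. Fix $-\infty<\beta_1<\alpha_1<\beta_2<\alpha_2<\cdots<\beta_n<\alpha_n<\infty$ and put $J_0=(-\infty,\beta_1)$, $J_k=(\alpha_k,\beta_{k+1})$ for $1\le k\le n-1$, $J_n=(\alpha_n,\infty)$, $\Omega=\bigcup_{k=0}^nJ_k$. Operator: $\mathscr{D}(P)$ is the set of $f\in L^2(\Omega)$ that are absolutely continuous on the components, with $f'\in L^2(\Omega)$. Such $f$ have one-sided limits $f(\beta_i)$ (from the left) and $f(\alpha_i)$ (from the right). For $B\in U(n)$, $P_B=\frac{1}{i2\pi}\frac{d}{dx}$ is the selfadjoint operator with domain $\{f\in\mathscr{D}(P): B(f(\beta_1),\dots,f(\beta_n))^T=(f(\alpha_1),\dots,f(\alpha_n))^T\}$, and $U_B(t)=e^{-i2\pi tP_B}$ is the unitary one-parameter group generated by $P_B$. Non-degeneracy: write $B=\begin{pmatrix}\boldsymbol u&B'\\ c&\boldsymbol w^*\end{pmatrix}$ with $\boldsymbol u,\boldsymbol w\in\mathbb{C}^{n-1}$, $c\in\mathbb{C}$ and $B'$ of size $(n-1)\times(n-1)$. $B$ is degenerate if $1\in\mathrm{sp}(B')$, non-degenerate otherwise. Generalized eigenfunctions: a generalized eigenfunction of $P_B$ at $\lambda\in\mathbb{R}$ is a function $\psi_\lambda^{(B)}=\left(\sum_{k=0}^nA_k(\lambda)\chi_{J_k}\right)e_\lambda$ with $A_k(\lambda)\in\mathbb{C}$, satisfying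 $B(\psi_\lambda^{(B)}(\beta_i))_i=(\psi_\lambda^{(B)}(\alpha_i))_i$. Spectral representation and the measure $\sigma_B$: for non-degenerate $B$ there is a system of bounded generalized eigenfunctions $\{\psi_\lambda^{(B)};\lambda\in\mathbb{R}\}$ and a positive Borel function $F_B$ on $\mathbb{R}$ such that $$(U_B(t)f)(x)=\int_{\mathbb{R}}e_\lambda(-t)\langle\psi_\lambda^{(B)},f\rangle_\Omega\,\psi_\lambda^{(B)}(x)\,F_B(\lambda)\,d\lambda$$ for all $f\in L^2(\Omega)$, $x\in\Omega$, $t\in\mathbb{R}$. These are the $\psi_\lambda^{(B)}$ and $F_B$ of the claim. The integrals for general $f\in L^2(\Omega)$ are understood in the $L^2$ (Plancherel) sense. *)

(* Defs.v *)
From HB Require Import structures.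
From mathcomp Require Import all_boot all_order all_algebra.
From mathcomp Require Import spectral.
From mathcomp Require Import all_classical all_reals all_analysis.
From mathcomp Require Import measurable_realfun complex.

Set Implicit Arguments.
Unset Strict Implicit.
Unset Printing Implicit Defensive.
Import Order.TTheory GRing.Theory Num.Theory.
Import numFieldNormedType.Exports.
Import ComplexField.Normc.

Local Open Scope classical_set_scope.
Local Open Scope ring_scope.

Section ComplexFunctions.
Context d (T : measurableType d) (R : realType).
Variables (mu : {measure set T -> \bar R}) (D : set T).
Implicit Types f g : T -> R[i].

Definition cmeasurable f :=
  measurable_fun D (fun x => complex.Re (f x)) /\
  measurable_fun D (fun x => complex.Im (f x)).

Definition cintegral f : R[i] :=
  Complex (\int[mu]_(x in D) complex.Re (f x))
          (\int[mu]_(x in D) complex.Im (f x)).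

Definition sqnormL2 f : \bar R := (\int[mu]_(x in D) (normc (f x) ^+ 2)%:E)%E.

(* L^2(D, mu) is handled through representatives: a function [f] with
   [inL2 f] stands for its class modulo equality mu-almost everywhere on D,
   and equalities between elements of L^2 are stated as [ae_eq mu D]. Operators
   between L^2 spaces are maps on representatives. *)
Definition inL2 f := cmeasurable f /\ (sqnormL2 f < +oo)%E.

(* Linear in the second variable. *)
Definition innerL2 f g : R[i] := cintegral (fun x => conjc (f x) * g x).

Definition cvgL2 (I : Type) (u : I -> T -> R[i]) (F : set_system I) f :=
  sqnormL2 (fun x => u i x - f x) @[i --> F] --> 0%E.

End ComplexFunctions.

Section Density.
Context (R : realType).
Variables (F : R -> R).

(* The measure d sigma = F d lambda; the two proof arguments make it a
   measure. *)
Definition density_measure (F0 : forall x, 0 < F x)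
    (mF : measurable_fun [set: R] F) (A : set (measurableTypeR R)) : \bar R :=
  (\int[lebesgue_measure]_(x in A) (F x)%:E)%E.

Hypothesis F0 : forall x, 0 < F x.
Hypothesis mF : measurable_fun [set: R] F.

Let density_measure0 : density_measure F0 mF set0 = 0%E.
Proof. by rewrite /density_measure integral_set0. Qed.

Let density_measure_ge0 A : (0 <= density_measure F0 mF A)%E.
Proof. by apply: integral_ge0 => x _; rewrite lee_fin ltW. Qed.

Let density_measure_sigma_additive : semi_sigma_additive (density_measure F0 mF).
Proof.
move=> A mA tA mUA.
have -> : density_measure F0 mF (\bigcup_n A n)
    = (\sum_(0 <= i <oo) density_measure F0 mF (A i))%E.
  rewrite /density_measure ge0_integral_bigcup//.
  - apply/measurable_EFinP; exact: measurable_funS mF.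
  - by move=> x _; rewrite lee_fin ltW.
by apply: is_cvg_nneseries => n _ _; exact: density_measure_ge0.
Qed.

HB.instance Definition _ := isMeasure.Build _ _ _ (density_measure F0 mF)
  density_measure0 density_measure_ge0 density_measure_sigma_additive.

End Density.

Section MomentumOperator.
Context (R : realType) (n : nat).
Variables (alpha beta : 'I_n -> R).

Local Notation mu := (@lebesgue_measure R).

(* e lambda x = e^{2 i pi lambda x} *)
Definition e (lambda x : R) : R[i] :=
  Complex (cos (2 * pi * lambda * x)) (sin (2 * pi * lambda * x)).

Definition i2pi : R[i] := Complex 0 (2 * pi).

(* beta_1 < alpha_1 < beta_2 < ... < beta_n < alpha_n, with indices shifted to
   start at 0. *)
Definition interlaced :=
  (forall i, beta i < alpha i) /\
  (forall i j : 'I_n, j = i.+1 :> nat -> alpha i < beta j).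

(* [unlift ord0 k] is the index of alpha_k (none for k = 0), and
   [unlift ord_max k] that of beta_{k+1} (none for k = n). *)
Definition J (k : 'I_n.+1) : set R :=
  [set` Interval
    (if unlift ord0 k is Some i then BRight (alpha i) else -oo%O)
    (if unlift ord_max k is Some i then BLeft (beta i) else +oo%O)].

Definition Omega : set R := \bigcup_k J k.

Definition absolutely_continuous_on (I : set R) (f : R -> R[i]) :=
  forall eps : R, 0 < eps -> exists2 delta : R, 0 < delta &
  forall (m : nat) (a b : 'I_m -> R),
    (forall i, a i <= b i /\ `[a i, b i]%classic `<=` I) ->
    (forall i j, i != j -> b i <= a j \/ b j <= a i) ->
    \sum_i (b i - a i) < delta ->
    \sum_i normc (f (b i) - f (a i)) < eps.

Definition has_derivative_at (f : R -> R[i]) (x : R) (l : R[i]) :=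
  normc ((h^-1)%:C%C * (f (x + h) - f x) - l) @[h --> (0 : R)^'] --> (0 : R).

Definition left_limit (f : R -> R[i]) (x : R) (l : R[i]) :=
  normc (f y - l) @[y --> x^'-] --> (0 : R).

Definition right_limit (f : R -> R[i]) (x : R) (l : R[i]) :=
  normc (f y - l) @[y --> x^'+] --> (0 : R).

(* B (f(beta_1), ..., f(beta_n))^T = (f(alpha_1), ..., f(alpha_n))^T *)
Definition boundary_condition (B : 'M[R[i]]_n) (f : R -> R[i]) :=
  exists fb fa : 'cV[R[i]]_n,
    [/\ forall i, left_limit f (beta i) (fb i 0),
        forall i, right_limit f (alpha i) (fa i 0)
      & B *m fb = fa].

(* f is in D(P), with derivative df *)
Definition domain_P (f df : R -> R[i]) :=
  [/\ inL2 mu Omega f, forall k, absolutely_continuous_on (J k) f,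
      {ae mu, forall x, Omega x -> has_derivative_at f x (df x)}
    & inL2 mu Omega df].

(* The graph of P_B as an operator in L^2(Omega): the class of [f] has a
   representative [f0] in the domain of P_B, and the class of [g] is
   (1 / 2 i pi) f0'. *)
Definition graph_P (B : 'M[R[i]]_n) (f g : R -> R[i]) :=
  exists f0 df : R -> R[i],
    [/\ ae_eq mu Omega f f0, domain_P f0 df, boundary_condition B f0
      & ae_eq mu Omega g (fun x => i2pi^-1 * df x)].

Definition unitary_operator (T : (R -> R[i]) -> (R -> R[i])) :=
  [/\ forall f, inL2 mu Omega f -> inL2 mu Omega (T f),
      forall (a : R[i]) f g, inL2 mu Omega f -> inL2 mu Omega g ->
        ae_eq mu Omega (T (fun x => a * f x + g x))
                       (fun x => a * T f x + T g x),
      forall f g, inL2 mu Omega f -> inL2 mu Omega g ->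
        innerL2 mu Omega (T f) (T g) = innerL2 mu Omega f g
    & forall g, inL2 mu Omega g ->
        exists2 f, inL2 mu Omega f & ae_eq mu Omega (T f) g].

Definition unitary_one_parameter_group (U : R -> (R -> R[i]) -> (R -> R[i])) :=
  [/\ forall t, unitary_operator (U t),
      forall f, inL2 mu Omega f -> ae_eq mu Omega (U 0 f) f,
      forall s t f, inL2 mu Omega f ->
        ae_eq mu Omega (U (s + t) f) (U s (U t f))
    & forall f, inL2 mu Omega f ->
        cvgL2 mu Omega (fun t => U t f) (nbhs (0 : R)) f].

(* U(t) = e^{-2 i pi t P_B}, in the sense of Stone's theorem: the infinitesimal
   generator of the strongly continuous unitary group U is -2 i pi P_B, with
   equality of domains. This determines U uniquely. *)
Definition group_generated_by_P (B : 'M[R[i]]_n)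
    (U : R -> (R -> R[i]) -> (R -> R[i])) :=
  unitary_one_parameter_group U /\
  forall f g, inL2 mu Omega f -> inL2 mu Omega g ->
    (graph_P B f g <->
     cvgL2 mu Omega (fun h x => (h^-1)%:C%C * (U h f x - f x)) ((0 : R)^')
       (fun x => - i2pi * g x)).

(* B', the upper right (n-1) x (n-1) corner: rows 1..n-1, columns 2..n *)
Definition ord_next (j : 'I_n.-1) : 'I_n :=
  Ordinal (etrans (esym (ltn_predRL j n)) (ltn_ord j)).

Definition upper_right_corner (B : 'M[R[i]]_n) : 'M[R[i]]_n.-1 :=
  mxsub (widen_ord (leq_pred n)) ord_next B.

Definition degenerate (B : 'M[R[i]]_n) := eigenvalue (upper_right_corner B) 1.

Definition generalized_eigenfunction (B : 'M[R[i]]_n) (lambda : R)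
    (psi : R -> R[i]) :=
  (exists A : 'I_n.+1 -> R[i], forall x, Omega x ->
     psi x = (\sum_k A k * \1_(J k) x) * e lambda x) /\
  boundary_condition B psi.

(* [psi lambda] is the generalized eigenfunction at lambda; Borel dependence on
   lambda is implicit in the integrals over lambda. *)
Definition bounded_eigenfunction_system (B : 'M[R[i]]_n)
    (psi : R -> R -> R[i]) :=
  [/\ forall lambda, generalized_eigenfunction B lambda (psi lambda),
      forall lambda, exists M : R, forall x, Omega x ->
        normc (psi lambda x) <= M
    & forall x, Omega x -> cmeasurable [set: R] (fun lambda => psi lambda x)].

Section SpectralTransform.
Variables (psi : R -> R -> R[i]) (F : R -> R).
Variables (F0 : forall x, 0 < F x) (mF : measurable_fun [set: R] F).

Local Notation sigma := (density_measure F0 mF).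
Local Notation window N := (`[- (N%:R : R), N%:R]%classic : set R).

(* g(lambda) = <psi_lambda, f>_Omega in the Plancherel sense: g is the limit in
   L^2(sigma) of the transforms of the truncations of f to [-N, N]. *)
Definition plancherel_transform (f g : R -> R[i]) :=
  inL2 sigma [set: R] g /\
  cvgL2 sigma [set: R]
    (fun (N : nat) lambda =>
       innerL2 mu (Omega `&` window N) (psi lambda) f) \oo g.

(* h(x) = \int g(lambda) psi_lambda(x) F(lambda) d lambda in the Plancherel
   sense: h is the limit in L^2(Omega) of the integrals over [-N, N]. *)
Definition plancherel_synthesis (g h : R -> R[i]) :=
  inL2 mu Omega h /\
  cvgL2 mu Omega
    (fun (N : nat) x =>
       cintegral mu (window N)
         (fun lambda => g lambda * psi lambda x * (F lambda)%:C%C)) \oo h.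

Definition spectral_representation (U : R -> (R -> R[i]) -> (R -> R[i])) :=
  forall f, inL2 mu Omega f -> exists2 g, plancherel_transform f g &
    forall t, plancherel_synthesis (fun lambda => e lambda (- t) * g lambda)
                                   (U t f).

Definition spectral_transform (V : (R -> R[i]) -> (R -> R[i])) :=
  forall f, inL2 mu Omega f -> plancherel_transform f (V f).

Definition adjoint_of (V Vs : (R -> R[i]) -> (R -> R[i])) :=
  (forall g, inL2 sigma [set: R] g -> inL2 mu Omega (Vs g)) /\
  (forall f g, inL2 mu Omega f -> inL2 sigma [set: R] g ->
     innerL2 sigma [set: R] (V f) g = innerL2 mu Omega f (Vs g)).

End SpectralTransform.

Definition modulation (t : R) (g : R -> R[i]) : R -> R[i] :=
  fun lambda => e lambda (- t) * g lambda.

End MomentumOperator.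

(* Main.v *)
Require Import Defs.
From HB Require Import structures.
From mathcomp Require Import all_boot all_order all_algebra.
From mathcomp Require Import spectral.
From mathcomp Require Import all_classical all_reals all_analysis.
From mathcomp Require Import measurable_realfun complex ring lra.
Import Order.TTheory GRing.Theory Num.Theory.
Import numFieldNormedType.Exports.

Set Implicit Arguments.
Unset Strict Implicit.
Unset Printing Implicit Defensive.

Local Open Scope classical_set_scope.
Local Open Scope ring_scope.
Local Notation normc := ComplexField.Normc.normc.

(** Fubini's theorem gives <f1, W_N g>_Omega = <V f1, 1_[-N,N] g>_sigma for f1 of
bounded support, where W_N is the synthesis integral over [-N, N]; letting N tend to
infinity, the spectral representation becomes <f1, U_t f> = <V f1, M_t V f>. At t = 0,
V is an isometry, so V* V = I; with f1 = U_t f, comparing norms gives V U_t = M_t V.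
Fubini applies because the coefficients A_k of psi on J_k are locally in L^2(sigma):
V maps the indicator of a short interval of J_k to conj(A_k) times a function that is
bounded away from 0 on [-N, N].

For V V* = I, let r = g - V V* g. It is orthogonal to every M_t V f, so conj(V f) r F
is an integrable function with zero Fourier transform, hence r vanishes wherever A_0
does not. Finally A_0 <> 0 almost everywhere: for w = |A_0|^2 F and the Fourier
transform h of the indicator of an interval I of the half-line J_0, the isometry
property on translates of I, modulated by a frequency xi, shows that the Fourier transform of
w(. + xi) |h|^2 does not depend on xi. So w is invariant under translations, and
being nonzero it cannot vanish on a set of positive measure. *)

(** The obstacle is surjectivity of V. Its range is stable under every M_t, so only a set of
    frequencies on which all V f vanish can obstruct it; ruling this out is what the claim on A_0 is
    for. The translation invariance of w has a simple source: a modulation by xi common to two waves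
    cancels in their inner product over Omega, whereas on the spectral side it moves h by xi and
    leaves w in place. The component J_0 is chosen because it contains a half-line: an interval in
    that half-line stays there under all translations s <= 0, which gives the Fourier transform on a
    half-line of frequencies, and the remaining ones follow since w and |h|^2 are real. A bounded
    component would only give a bounded range of s. *)

Section RealIntegrable.
Context d (T : measurableType d) (R : realType).
Variables (m : {measure set T -> \bar R}) (D : set T).
Hypothesis mD : measurable D.
Implicit Types f g h p : T -> R.

Lemma integrableD_EFin f g : m.-integrable D (EFin \o f) ->
  m.-integrable D (EFin \o g) -> m.-integrable D (EFin \o (fun x => f x + g x)).
Proof. by move=> jf jg; apply: eq_integrable (integrableD mD jf jg). Qed.

Lemma integrableB_EFin f g : m.-integrable D (EFin \o f) ->
  m.-integrable D (EFin \o g) -> m.-integrable D (EFin \o (fun x => f x - g x)).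
Proof. by move=> jf jg; apply: eq_integrable (integrableB mD jf jg). Qed.

Lemma integrableZl_EFin c f : m.-integrable D (EFin \o f) ->
  m.-integrable D (EFin \o (fun x => c * f x)).
Proof. by move=> jf; apply: eq_integrable (integrableZl mD c jf). Qed.

Lemma integrable_mul_bounded h p (C : R) :
  m.-integrable D (EFin \o h) -> measurable_fun D p ->
  (forall x, D x -> `|p x| <= C) ->
  m.-integrable D (EFin \o (fun x => h x * p x)).
Proof.
move=> ih mp pC.
have -> : EFin \o (fun x => h x * p x) = ((EFin \o h) \* (EFin \o p))%E.
  by apply/funext => x /=; rewrite EFinM.
apply: integrableMl => //.
exists `|C|; split=> [|M CM x Dx /=]; first exact: normr_real.
by rewrite (le_trans (pC _ Dx))// (le_trans (ler_norm C))// ltW.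
Qed.

Lemma Rintegral_dominated_cvg (u : nat -> T -> R) f g :
  (forall n, measurable_fun D (u n)) -> measurable_fun D f ->
  (forall x, D x -> u ^~ x @ \oo --> f x) ->
  m.-integrable D (EFin \o g) -> (forall n x, D x -> `|u n x| <= g x) ->
  \int[m]_(x in D) u n x @[n --> \oo] --> \int[m]_(x in D) f x.
Proof.
move=> mu_ mf uf ig ug.
have [] := @dominated_convergence _ _ _ m D mD (fun n => EFin \o u n) (EFin \o f) (EFin \o g).
- by move=> n; exact/measurable_EFinP.
- exact/measurable_EFinP.
- by apply: aeW => x Dx; apply/cvg_EFin; [exact: nearW|exact: uf].
- exact: ig.
- by apply: aeW => x n Dx /=; rewrite lee_fin; exact: ug.
move=> if_ _ cv; apply: fine_cvg; rewrite fineK//.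
exact: integrable_fin_num.
Qed.

End RealIntegrable.

(** * Injectivity of the Fourier transform on L^1 *)

Section FourierUniqueness.
Context (R : realType).
Local Notation mu := (@lebesgue_measure R).
Implicit Types (h p q : R -> R).

(** The Fourier transform of a real function, split into cosine and sine parts so that only real
    integrals occur. *)
Definition vanishing_transform h :=
  mu.-integrable setT (EFin \o h) /\
  forall t, \int[mu]_x (h x * cos (t * x)) = 0 /\
            \int[mu]_x (h x * sin (t * x)) = 0.

Lemma measurable_cosM t : measurable_fun [set: R] (fun x : R => cos (t * x)).
Proof.
apply: continuous_measurable_fun => x.
by apply: continuous_comp; [exact: mulrl_continuous|exact: continuous_cos].
Qed.

Lemma measurable_sinM t : measurable_fun [set: R] (fun x : R => sin (t * x)).
Proof.
apply: continuous_measurable_fun => x.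
by apply: continuous_comp; [exact: mulrl_continuous|exact: continuous_sin].
Qed.

(* Multipliers form an algebra closed under bounded pointwise limits; it contains the
   functions cos (t x) and sin (t x), and from these one reaches every indicator. *)
Definition multiplier p :=
  [/\ measurable_fun [set: R] p, exists C, forall x, `|p x| <= C
    & forall h, vanishing_transform h -> vanishing_transform (fun x => h x * p x)].

Lemma integrable_mul_cos h t : mu.-integrable setT (EFin \o h) ->
  mu.-integrable setT (EFin \o (fun x => h x * cos (t * x))).
Proof.
by move=> ih; apply: (integrable_mul_bounded _ (C := 1)) => //;
  [exact: measurable_cosM | move=> x _; exact: cos_max].
Qed.

Lemma integrable_mul_sin h t : mu.-integrable setT (EFin \o h) ->
  mu.-integrable setT (EFin \o (fun x => h x * sin (t * x))).
Proof.
by move=> ih; apply: (integrable_mul_bounded _ (C := 1)) => //;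
  [exact: measurable_sinM | move=> x _; exact: sin_max].
Qed.

Lemma vanishing_transformZ h (c : R) : vanishing_transform h ->
  vanishing_transform (fun x => c * h x).
Proof.
move=> [ih h0]; split=> [|t].
  exact: integrableZl_EFin.
split; under eq_Rintegral do rewrite -mulrA.
  rewrite RintegralZl//; [by rewrite (h0 t).1 mulr0|exact: integrable_mul_cos].
rewrite RintegralZl//; [by rewrite (h0 t).2 mulr0|exact: integrable_mul_sin].
Qed.

Lemma vanishing_transformD h1 h2 : vanishing_transform h1 ->
  vanishing_transform h2 -> vanishing_transform (fun x => h1 x + h2 x).
Proof.
move=> [ih1 h10] [ih2 h20]; split=> [|t].
  exact: integrableD_EFin.
split; under eq_Rintegral do rewrite mulrDl.
  by rewrite RintegralD// ?(h10 t).1 ?(h20 t).1 ?addr0//; exact: integrable_mul_cos.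
by rewrite RintegralD// ?(h10 t).2 ?(h20 t).2 ?addr0//; exact: integrable_mul_sin.
Qed.

Lemma multiplier_cst c : multiplier (fun=> c).
Proof.
split; [exact: measurable_cst|by exists `|c| | move=> h /(vanishing_transformZ c)].
by under eq_fun do rewrite mulrC.
Qed.

Lemma multiplierD p q : multiplier p -> multiplier q ->
  multiplier (fun x => p x + q x).
Proof.
move=> [mp [C pC] gp] [mq [D qD] gq]; split.
- exact: measurable_funD.
- by exists (C + D) => x; rewrite (le_trans (ler_normD _ _))// lerD.
- move=> h hv; under eq_fun do rewrite mulrDr.
  by apply: vanishing_transformD; [exact: gp|exact: gq].
Qed.

Lemma multiplierM p q : multiplier p -> multiplier q ->
  multiplier (fun x => p x * q x).
Proof.
move=> [mp [C pC] gp] [mq [D qD] gq]; split.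
- exact: measurable_funM.
- by exists (C * D) => x; rewrite normrM ler_pM.
- move=> h hv; under eq_fun do rewrite mulrA.
  by apply: gq; exact: gp.
Qed.

Lemma multiplierZ c p : multiplier p -> multiplier (fun x => c * p x).
Proof. by apply: multiplierM; exact: multiplier_cst. Qed.

Lemma multiplierX p n : multiplier p -> multiplier (fun x => p x ^+ n).
Proof.
move=> gp; elim: n => [|n ih]; first by under eq_fun do rewrite expr0; exact: multiplier_cst.
by under eq_fun do rewrite exprS; exact: multiplierM.
Qed.

(** Product-to-sum formulas: the transform of h(x) cos(t x) at s is a half sum of values of the
    transform of h at t + s and t - s. *)
Lemma multiplier_cos t : multiplier (fun x => cos (t * x)).
Proof.
split; [exact: measurable_cosM|by exists 1 => x; exact: cos_max|].
move=> h [ih h0]; split=> [|s]; first exact: integrable_mul_cos.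
split.
  rewrite (_ : (fun x => _) = fun x => 2^-1 * (h x * cos ((t + s) * x) + h x * cos ((t - s) * x))).
    rewrite RintegralZl ?RintegralD//; try exact: integrable_mul_cos.
      by rewrite (h0 (t + s)).1 (h0 (t - s)).1 addr0 mulr0.
    by apply: integrableD_EFin => //; exact: integrable_mul_cos.
  by apply/funext => x; rewrite (mulrDl t s) (mulrDl t (-s)) mulNr cosD cosB; field.
rewrite (_ : (fun x => _) = fun x => 2^-1 * (h x * sin ((t + s) * x) - h x * sin ((t - s) * x))).
  rewrite RintegralZl ?RintegralB//; try exact: integrable_mul_sin.
    by rewrite (h0 (t + s)).2 (h0 (t - s)).2 subr0 mulr0.
  by apply: integrableB_EFin => //; exact: integrable_mul_sin.
by apply/funext => x; rewrite (mulrDl t s) (mulrDl t (-s)) mulNr sinD sinB; field.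
Qed.

Lemma multiplier_sin t : multiplier (fun x => sin (t * x)).
Proof.
split; [exact: measurable_sinM|by exists 1 => x; exact: sin_max|].
move=> h [ih h0]; split=> [|s]; first exact: integrable_mul_sin.
split.
  rewrite (_ : (fun x => _) = fun x => 2^-1 * (h x * sin ((t + s) * x) + h x * sin ((t - s) * x))).
    rewrite RintegralZl ?RintegralD//; try exact: integrable_mul_sin.
      by rewrite (h0 (t + s)).2 (h0 (t - s)).2 addr0 mulr0.
    by apply: integrableD_EFin => //; exact: integrable_mul_sin.
  by apply/funext => x; rewrite (mulrDl t s) (mulrDl t (-s)) mulNr sinD sinB; field.
rewrite (_ : (fun x => _) = fun x => 2^-1 * (h x * cos ((t - s) * x) - h x * cos ((t + s) * x))).
  rewrite RintegralZl ?RintegralB//; try exact: integrable_mul_cos.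
    by rewrite (h0 (t + s)).1 (h0 (t - s)).1 subr0 mulr0.
  by apply: integrableB_EFin => //; exact: integrable_mul_cos.
by apply/funext => x; rewrite (mulrDl t s) (mulrDl t (-s)) mulNr cosB cosD; field.
Qed.

(** Dominated convergence: the uniform bound [C] makes a multiple of |h| a majorant. *)
Lemma multiplier_cvg (u : nat -> R -> R) p C : (forall n, multiplier (u n)) ->
  (forall n x, `|u n x| <= C) -> (forall x, u ^~ x @ \oo --> p x) ->
  multiplier p.
Proof.
move=> gu uC up.
have mp : measurable_fun setT p.
  by apply: (@measurable_fun_cvg _ _ _ _ u) => // n; have [] := gu n.
have pC x : `|p x| <= C.
  have cx : `|u n x| @[n --> \oo] --> `|p x| by apply: cvg_norm; exact: up.
  rewrite -(cvg_lim (@norm_hausdorff _ _) cx); apply: limr_le.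
    by apply/cvg_ex; exists `|p x|.
  by apply: nearW => n; exact: uC.
split => //; first by exists C.
move=> h hv; have [ih h0] := hv; split=> [|t]; first exact: (integrable_mul_bounded _ (C := C)).
(* One limit argument for both [q] = cos(t x) and [q] = sin(t x). *)
suff key (q : R -> R) : measurable_fun setT q -> (forall x, `|q x| <= 1) ->
    (forall n, \int[mu]_x (h x * u n x * q x) = 0) ->
    \int[mu]_x (h x * p x * q x) = 0.
  split; apply: key.
  - exact: measurable_cosM.
  - by move=> x; exact: cos_max.
  - by move=> n; have [_ _ /(_ _ hv)[_ /(_ t)[]]] := gu n.
  - exact: measurable_sinM.
  - by move=> x; exact: sin_max.
  - by move=> n; have [_ _ /(_ _ hv)[_ /(_ t)[]]] := gu n.
move=> mq q1 hu0.
have mh : measurable_fun setT h by apply/measurable_EFinP; exact: measurable_int ih.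
have cv : \int[mu]_x (h x * u n x * q x) @[n --> \oo] --> \int[mu]_x (h x * p x * q x).
  apply: (@Rintegral_dominated_cvg _ _ _ mu setT measurableT
    (fun n x => h x * u n x * q x) (fun x => h x * p x * q x)
    (fun x => `|C| * `|h x|)) => //.
  - by move=> n; do 2!apply: measurable_funM => //; have [] := gu n.
  - by do 2!apply: measurable_funM => //.
  - by move=> x _; apply: cvgM; [apply: cvgM; [exact: cvg_cst|exact: up]|exact: cvg_cst].
  - by apply: integrableZl_EFin => //; exact: (integrable_norm ih).
  - move=> n x _; rewrite !normrM -[leRHS]mulr1 ler_pM// ?mulr_ge0// mulrC ler_pM//.
    by rewrite (le_trans (uC n x))// ler_norm.
have : (fun n => \int[mu]_x (h x * u n x * q x)) @ \oo --> (0 : R).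
  by under eq_fun do rewrite hu0; exact: cvg_cst.
by move/(cvg_unique _ cv) => /(_ (@norm_hausdorff _ _)).
Qed.

(* Since (1 - y)(1 + y) <= 1, Bernoulli's inequality applies to both powers. *)
Lemma expr1B_le (y : R) (m : nat) : 0 <= y <= 1 ->
  (1 - y) ^+ m <= (1 + y *+ m)^-1.
Proof.
move=> /andP[y0 y1]; have den0 : 0 < 1 + y *+ m by rewrite ltr_pwDl// mulrn_wge0.
rewrite -[leRHS]mul1r ler_pdivlMr//.
have : ((1 - y) * (1 + y)) ^+ m <= 1.
  by apply: exprn_ile1; nra.
apply: le_trans; rewrite exprMn ler_wpM2l//; first by rewrite exprn_ge0// subr_ge0.
rewrite -mulr_natl mulrC; apply: (le_trans _ (_ : 1 + m%:R * y <= _)).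
  by rewrite mulrC.
elim: m {den0} => [|m ih]; first by rewrite mul0r addr0 expr0.
rewrite exprS (le_trans _ (ler_wpM2l _ ih))//; last lra.
rewrite -natr1; have : 0 <= m%:R :> R by []. nra.
Qed.

Lemma expr1B_ge (y : R) (m : nat) : 0 <= y <= 1 -> 1 - y *+ m <= (1 - y) ^+ m.
Proof.
move=> /andP[y0 y1]; rewrite -mulr_natl.
elim: m => [|m ih]; first by rewrite mul0r subr0 expr0.
rewrite exprS (le_trans _ (ler_wpM2l _ ih))//; last lra.
rewrite -natr1; have : 0 <= m%:R :> R by []. nra.
Qed.

(** Mean value theorem: sin x = x cos c with c in [0, x], and cos decreases on [0, 1]. The constant
    cos 1 serves throughout as an explicit positive lower bound. *)
Lemma sin_ge_cos1 (x : R) : 0 <= x <= 1 -> cos 1 * x <= sin x.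
Proof.
move=> /andP[x0 x1].
have [c cx] : exists2 c, c \in `[0, x] & sin x - sin 0 = cos c * (x - 0).
  apply: MVT_segment => //; last by apply: continuous_subspaceT => y; exact: continuous_sin.
rewrite sin0 !subr0 => ->; rewrite ler_wpM2r//.
have /[!in_itv]/= /andP[c0 cx'] := cx.
have pi2 : 2 <= pi :> R := pi_ge2 R.
have [->//|c1] := eqVneq c 1.
rewrite ltW// ltr_cos ?in_itv/=; [|lra|lra].
by rewrite lt_neqAle c1/=; lra.
Qed.

Lemma cvg_harmonicZ (a : R) : a / n.+1%:R @[n --> \oo] --> (0 : R).
Proof.
rewrite -[X in _ --> X](mulr0 a); apply: cvgM; first exact: cvg_cst.
exact: cvg_harmonic.
Qed.

(* With N = n + 1 and y = (1 - sin((x - a)/N))/2 in [0, 1], the power N 2^(N^3) of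
   1 - y^(N^3) is at most 1/(1 + N) where 2 y >= 1 (that is, eventually when x <= a)
   and at least 1 - N (2 y)^(N^3) where 2 y < 1. *)
Lemma multiplier_ray a : multiplier (\1_`]a, +oo[ : R -> R).
Proof.
pose y n x : R := (1 - sin (n.+1%:R^-1 * x - n.+1%:R^-1 * a)) / 2.
pose m n := (n.+1 ^ 3)%N.
pose u n x : R := (1 - y n x ^+ m n) ^+ (n.+1 * 2 ^ m n).
have y01 n x : 0 <= y n x <= 1.
  rewrite /y; set s := sin _; have := sin_le1 (n.+1%:R^-1 * x - n.+1%:R^-1 * a).
  have := sin_geN1 (n.+1%:R^-1 * x - n.+1%:R^-1 * a); rewrite -/s; lra.
have ym01 n x : 0 <= y n x ^+ m n <= 1.
  by have /andP[y0 y1] := y01 n x; rewrite exprn_ge0// exprn_ile1.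
have u01 n x : 0 <= u n x <= 1.
  have /andP[y0 y1] := ym01 n x.
  by rewrite /u exprn_ge0 ?exprn_ile1//; lra.
have ymE n x : y n x ^+ m n *+ (n.+1 * 2 ^ m n) = (2 * y n x) ^+ m n *+ n.+1.
  by rewrite mulnC mulrnA [(2 * _) ^+ _]exprMn -(mulr_natl _ (2 ^ m n)%N) natrX.
apply: (@multiplier_cvg u _ 1).
- move=> n; apply: multiplierX.
  rewrite (_ : (fun x => _) = fun x => 1 + -1 * y n x ^+ m n); last first.
    by apply/funext => x; rewrite mulN1r.
  apply: multiplierD; first exact: multiplier_cst.
  apply: multiplierZ; apply: multiplierX.
  rewrite (_ : y n = fun x => 2^-1 + (- 2^-1 * cos (n.+1%:R^-1 * a) * sin (n.+1%:R^-1 * x)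
     + 2^-1 * sin (n.+1%:R^-1 * a) * cos (n.+1%:R^-1 * x))); last first.
    by apply/funext => x; rewrite /y sinB; field.
  apply: multiplierD; first exact: multiplier_cst.
  by apply: multiplierD; apply: multiplierZ; [exact: multiplier_sin|exact: multiplier_cos].
- by move=> n x; have /andP[u0 u1] := u01 n x; rewrite ger0_norm.
move=> x; rewrite indicE.
have [ax|xa] := ltP a x.
  rewrite mem_set/= ?in_itv/= ?ax// mulr1n.
  pose d := x - a; have d0 : 0 < d by rewrite subr_gt0.
  have k0 : 0 < cos 1 * d :> R by rewrite mulr_gt0// cos1_gt0.
  apply: (@squeeze_cvgr _ _ _ _ (fun n => 1 - (cos 1 * d)^-1 / n.+1%:R) (cst 1)); last first.
  + exact: cvg_cst.
  + by rewrite -[X in _ --> X]subr0; apply: cvgB; [exact: cvg_cst|exact: cvg_harmonicZ].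
  near=> n; have /andP[_ ->] := u01 n x; rewrite andbT.
  apply: le_trans (expr1B_ge _ (ym01 n x)).
  rewrite lerD2l lerN2 ymE.
  have n0 : 0 < n.+1%:R :> R by [].
  have th : cos 1 * (d / n.+1%:R) <= sin (n.+1%:R^-1 * x - n.+1%:R^-1 * a).
    rewrite -mulrBr [_^-1 * _]mulrC; apply: sin_ge_cos1.
    have t0 : 0 <= d / n.+1%:R by rewrite divr_ge0 ?ltW.
    rewrite t0 ler_pdivrMr// mul1r.
    rewrite (@le_trans _ _ n%:R) ?ler_nat//.
    by near: n; exact: nbhs_infty_ger.
  have s1 := sin_le1 (n.+1%:R^-1 * x - n.+1%:R^-1 * a).
  have z0 : 0 <= cos 1 * (d / n.+1%:R) by rewrite mulrA divr_ge0 ?ltW.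
  have b1 : (2 * y n x) ^+ m n <= (1 + (cos 1 * (d / n.+1%:R)) *+ m n)^-1.
    apply: le_trans (expr1B_le _ _); last by rewrite z0 (le_trans th).
    move: th s1 z0 (y01 n x); rewrite /y.
    set z := cos 1 * _; set s := sin _ => th s1 z0 _.
    by apply: lerXn2r; rewrite ?nnegrE; lra.
  rewrite -mulr_natl; apply: le_trans (ler_wpM2l _ b1) _ => //.
  rewrite -[_ *+ m n]mulr_natl.
  (* The reason for the cube in [m]: it beats both the 1/N in the sine and the outer factor N,
     leaving a bound of order 1/N. With N^2 the bound would not tend to 0. *)
  have -> : (m n)%:R * (cos 1 * (d / n.+1%:R)) = cos 1 * d * n.+1%:R ^+ 2 :> R.
    rewrite /m natrX; field; exact: lt0r_neq0.
  rewrite ler_pdivrMr; last by rewrite ltr_pwDl// mulr_ge0 ?exprn_ge0// ltW.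
  rewrite mulrDr (_ : _ * (cos 1 * d * _) = n.+1%:R); last first.
    by field; rewrite !lt0r_neq0// cos1_gt0.
  by rewrite lerDr mulr1 divr_ge0// invr_ge0 ltW.
rewrite memNset/= ?in_itv/= ?ltNge ?xa// mulr0n.
apply: (@squeeze_cvgr _ _ _ _ (cst 0) (fun n => 1 / n.+1%:R)); last first.
+ exact: cvg_harmonicZ.
+ exact: cvg_cst.
near=> n; have /andP[-> _] /= := u01 n x.
apply: le_trans (expr1B_le _ (ym01 n x)) _.
rewrite ymE mul1r lef_pV2 ?posrE//; last first.
  by rewrite ltr_pwDl// mulrn_wge0// exprn_ge0// mulr_ge0//; have /andP[] := y01 n x.
rewrite -[leLHS]add0r lerD// lerMn2r/=.
apply: exprn_ege1; rewrite /y mulrC divfK//.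
have -> : n.+1%:R^-1 * x - n.+1%:R^-1 * a = - ((a - x) / n.+1%:R).
  by rewrite -mulrBr mulrC -mulNr opprB.
rewrite sinN opprK lerDl; apply: le_trans (sin_ge_cos1 _).
  by rewrite mulr_ge0 ?(ltW (cos1_gt0 _))// divr_ge0 ?subr_ge0.
rewrite divr_ge0 ?subr_ge0//= ler_pdivrMr// mul1r.
rewrite (@le_trans _ _ n%:R) ?ler_nat//.
by near: n; exact: nbhs_infty_ger.
Unshelve. all: by end_near. Qed.

(** The sets whose indicator is a multiplier form a sigma-algebra, and it contains the open rays,
    which generate the Borel sets. *)
Lemma multiplier_indic (A : set R) : measurable A -> multiplier (\1_A : R -> R).
Proof.
have key : (@RGenOInfty.G R).-sigma.-measurable `<=` [set A | multiplier (\1_A : R -> R)].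
  apply: smallest_sub => [|_ [a ->]]; last exact: multiplier_ray.
  split => /=.
  - by rewrite indic0; exact: multiplier_cst.
  - move=> B gB; rewrite (_ : \1_ _ = fun x => 1 + -1 * \1_B x).
      by apply: multiplierD; [exact: multiplier_cst|exact: multiplierZ].
    by apply/funext => x; rewrite indicE mulN1r indicE in_setD in_setT/=; case: (_ \in _); rewrite ?subrr ?subr0.
  move=> B gB.
  (* The indicator of the union of the first [n] sets, written within the algebra of multipliers. *)
  pose u n x : R := 1 + -1 * \prod_(i < n) (1 + -1 * \1_(B i) x).
  apply: (@multiplier_cvg u _ 1).
  - move=> n; apply: multiplierD; first exact: multiplier_cst.
    apply: multiplierZ; elim: n => [|n ih].
      by under eq_fun do rewrite big_ord0; exact: multiplier_cst.
    under eq_fun do rewrite big_ord_recr/=.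
    apply: multiplierM => //; apply: multiplierD; first exact: multiplier_cst.
    exact: multiplierZ.
  - move=> n x; have : 0 <= \prod_(i < n) (1 + -1 * \1_(B i) x : R) <= 1.
      by elim/big_ind: _ => [|a b /andP[? ?] /andP[? ?]|i _]; [lra| |rewrite indicE; case: (_ \in _) => /=; rewrite ?mulr1n ?mulr0n; lra]; rewrite mulr_ge0 ?mulr_ile1//; lra.
    by rewrite /u ler_norml; lra.
  move=> x; have [[i _ Bix]|nB] := pselect ((\bigcup_k B k) x).
    rewrite indicE mem_set; last by exists i.
    apply: cvg_near_cst; near=> n.
    have lin : (i < n)%N by near: n; exact: nbhs_infty_gt.
    by rewrite /u (bigD1 (Ordinal lin))//= indicE mem_set//= mulr1 subrr mul0r mulr0 addr0.
  rewrite indicE memNset//; apply: cvg_near_cst; near=> n.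
  rewrite /u big1 ?mulr1 ?subrr// => k _; rewrite indicE memNset ?mulr0 ?addr0//.
  by move=> Bk; apply: nB; exists k.
move=> mA; apply: key; rewrite -RGenOInfty.measurableE; exact: mA.
Unshelve. all: by end_near. Qed.

(** At frequency 0, the multiplier 1_E yields a zero integral of h over each measurable E. *)
Theorem vanishing_transform_ae0 h : vanishing_transform h ->
  {ae mu, forall x, h x = 0}.
Proof.
move=> hv; have [ih _] := hv.
have : ae_eq mu setT (EFin \o h) (cst 0%E).
  apply: (integral_ae_eq measurableT ih) => [|E _ mE]; first exact: measurable_cst.
  have [_ _ mulE] := multiplier_indic mE; have [iE /(_ 0)[+ _]] := mulE _ hv.
  under eq_Rintegral do rewrite mul0r cos0 mulr1.
  move=> hE; rewrite [RHS]integral0_eq//.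
  have -> : (\int[mu]_(x in E) (EFin \o h) x)%E = (\int[mu]_x (h x * \1_E x)%:E)%E.
    rewrite integral_mkcond; apply: eq_integral => x _ /=.
    by rewrite /patch indicE; case: (_ \in _); rewrite ?mulr1 ?mulr0.
  rewrite -[LHS]fineK; first by congr EFin; exact: hE.
  exact: integrable_fin_num iE.
by apply: filterS => x /(_ I) [].
Qed.

End FourierUniqueness.
(** * Complex-valued L^2 functions *)

Section ComplexL2.
Context d (T : measurableType d) (R : realType).
Variables (m : {measure set T -> \bar R}) (D : set T).
Hypothesis mD : measurable D.
Implicit Types (a b : T -> R) (f g h : T -> R[i]).

Definition sqint a :=
  measurable_fun D a /\ m.-integrable D (EFin \o (fun x => a x ^+ 2)).

Lemma sqint_mul a b : sqint a -> sqint b ->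
  m.-integrable D (EFin \o (fun x => a x * b x)).
Proof.
move=> [ma ia] [mb ib]; apply: le_integrable (integrableD_EFin mD ia ib) => //.
  by apply/measurable_EFinP; exact: measurable_funM.
move=> x _; rewrite lee_fin [leRHS]ger0_norm ?addr_ge0 ?sqr_ge0// ler_norml.
have := sqr_ge0 (a x + b x); have := sqr_ge0 (a x - b x).
have := sqr_ge0 (a x); have := sqr_ge0 (b x).
by move=> *; apply/andP; split; nra.
Qed.

Lemma sqintD a b : sqint a -> sqint b -> sqint (fun x => a x + b x).
Proof.
move=> sa sb; have [ma ia] := sa; have [mb ib] := sb.
split; first exact: measurable_funD.
apply: eq_integrable (integrableD_EFin mD (integrableD_EFin mD ia ib)
  (integrableZl_EFin mD 2 (sqint_mul sa sb))) => // x _ /=.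
by congr EFin; ring.
Qed.

Lemma sqint_bounded_mul a (c : T -> R) (K : R) : sqint a -> measurable_fun D c ->
  (forall x, D x -> `|c x| <= K) -> sqint (fun x => c x * a x).
Proof.
move=> [ma ia] mc cK; split; first exact: measurable_funM.
have ib : m.-integrable D (EFin \o (fun x => a x ^+ 2 * c x ^+ 2)).
  apply: (integrable_mul_bounded mD ia (C := K ^+ 2)); first exact: measurable_funX.
  by move=> x Dx; rewrite normrX lerXn2r ?nnegrE ?cK// (le_trans _ (cK x Dx)).
by apply: eq_integrable ib => // x _ /=; rewrite exprMn mulrC.
Qed.

Lemma normc_sqr (z : R[i]) : normc z ^+ 2 = complex.Re z ^+ 2 + complex.Im z ^+ 2.
Proof. by case: z => x y /=; rewrite sqr_sqrtr// addr_ge0 ?sqr_ge0. Qed.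

Lemma inL2P f : inL2 m D f <->
  sqint (fun x => complex.Re (f x)) /\ sqint (fun x => complex.Im (f x)).
Proof.
split.
  move=> [[mRe mIm] fin].
  have isq : m.-integrable D (EFin \o (fun x => normc (f x) ^+ 2)).
    apply/integrableP; split.
      apply/measurable_EFinP; under eq_fun do rewrite normc_sqr.
      by apply: measurable_funD; exact: measurable_funX.
    by under eq_integral do rewrite gee0_abs ?lee_fin ?sqr_ge0//.
  split; split => //.
    apply: le_integrable isq => //; first by apply/measurable_EFinP; exact: measurable_funX.
    move=> x _; rewrite lee_fin !ger0_norm ?sqr_ge0// normc_sqr.
    by rewrite lerDl sqr_ge0.
  apply: le_integrable isq => //; first by apply/measurable_EFinP; exact: measurable_funX.
  move=> x _; rewrite lee_fin !ger0_norm ?sqr_ge0// normc_sqr.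
  by rewrite lerDr sqr_ge0.
move=> [[mRe iRe] [mIm iIm]]; split => //.
have /integrableP[_] := integrableD_EFin mD iRe iIm.
apply: le_lt_trans; rewrite le_eqVlt; apply/orP; left; apply/eqP.
apply: eq_integral => x _ /=.
by rewrite normc_sqr ger0_norm// addr_ge0 ?sqr_ge0.
Qed.

Lemma cmeasurable_inL2 f : inL2 m D f -> cmeasurable D f.
Proof. by case. Qed.

Lemma inL2D f g : inL2 m D f -> inL2 m D g -> inL2 m D (fun x => f x + g x).
Proof.
move=> /inL2P[f1 f2] /inL2P[g1 g2]; apply/inL2P; split.
  by under eq_fun do rewrite raddfD; exact: sqintD.
by under eq_fun do rewrite raddfD; exact: sqintD.
Qed.

Lemma inL2_bounded_mul (c : T -> R[i]) (K : R) f : inL2 m D f ->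
  cmeasurable D c ->
  (forall x, D x -> `|complex.Re (c x)| <= K) ->
  (forall x, D x -> `|complex.Im (c x)| <= K) ->
  inL2 m D (fun x => c x * f x).
Proof.
move=> /inL2P[f1 f2] [c1 c2] K1 K2; apply/inL2P; split.
  rewrite (_ : (fun x => _) = fun x => complex.Re (c x) * complex.Re (f x) +
      (- complex.Im (c x)) * complex.Im (f x)).
    apply: sqintD; first exact: (sqint_bounded_mul (K := K)).
    apply: (sqint_bounded_mul (K := K)) => //; first exact: measurable_funN.
    by move=> x Dx; rewrite normrN K2.
  by apply/funext => x; case: (c x) => ? ?; case: (f x) => ? ? /=; rewrite mulNr.
rewrite (_ : (fun x => _) = fun x => complex.Re (c x) * complex.Im (f x) +
    complex.Im (c x) * complex.Re (f x)).
  by apply: sqintD; exact: (sqint_bounded_mul (K := K)).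
by apply/funext => x; case: (c x) => ? ?; case: (f x) => ? ? /=.
Qed.

Lemma inL2Z (c : R[i]) f : inL2 m D f -> inL2 m D (fun x => c * f x).
Proof.
move=> fL; apply: (inL2_bounded_mul (c := fun=> c)
  (K := Num.max `|complex.Re c| `|complex.Im c|)) => //.
- by move=> x _; rewrite le_max lexx.
- by move=> x _; rewrite le_max lexx orbT.
Qed.

Lemma inL2B f g : inL2 m D f -> inL2 m D g -> inL2 m D (fun x => f x - g x).
Proof.
move=> fL gL; under eq_fun do rewrite -mulN1r.
by apply: inL2D => //; exact: inL2Z.
Qed.

(* Identities between real parts of inner products suffice: multiplying [f] by i gives
   the imaginary part. *)
Definition rip f g : R := \int[m]_(x in D)
  (complex.Re (f x) * complex.Re (g x) + complex.Im (f x) * complex.Im (g x)).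

Lemma Re_conjcM (z w : R[i]) : complex.Re (conjc z * w) =
  complex.Re z * complex.Re w + complex.Im z * complex.Im w.
Proof. by case: z w => x y [u v] /=; rewrite mulNr opprK. Qed.

Lemma Re_innerL2 f g : complex.Re (innerL2 m D f g) = rip f g.
Proof. by apply: eq_Rintegral => x _; rewrite Re_conjcM. Qed.

Lemma rip_integrable f g : inL2 m D f -> inL2 m D g ->
  m.-integrable D (EFin \o (fun x => complex.Re (f x) * complex.Re (g x) +
    complex.Im (f x) * complex.Im (g x))).
Proof.
by move=> /inL2P[f1 f2] /inL2P[g1 g2]; apply: integrableD_EFin => //; exact: sqint_mul.
Qed.

Lemma ripC f g : rip f g = rip g f.
Proof. by apply: eq_Rintegral => x _; congr (_ + _); rewrite mulrC. Qed.

Lemma ripBr f g h : inL2 m D f -> inL2 m D g -> inL2 m D h ->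
  rip f (fun x => g x - h x) = rip f g - rip f h.
Proof.
move=> fL gL hL; rewrite -RintegralB//; [|exact: rip_integrable..].
by apply: eq_Rintegral => x _; rewrite !raddfB/=; ring.
Qed.

Lemma sqnormL2_rip f : inL2 m D f -> sqnormL2 m D f = (rip f f)%:E.
Proof.
move=> fL; rewrite fineK.
  by apply: eq_integral => x _; rewrite normc_sqr -!expr2.
exact: integrable_fin_num (rip_integrable fL fL).
Qed.

Lemma rip_ge0 f : 0 <= rip f f.
Proof. by apply: Rintegral_ge0 => x _; rewrite -!expr2 addr_ge0 ?sqr_ge0. Qed.

Lemma rip_eq0 f : inL2 m D f -> rip f f = 0 -> ae_eq m D f (cst 0).
Proof.
move=> fL f0.
have iff := rip_integrable fL fL.
have [+ _] := ae_eq_integral_abs m mD (measurable_int _ iff).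
rewrite [X in X = 0%E -> _](_ : _ = (rip f f)%:E); last first.
  rewrite -sqnormL2_rip//; apply: eq_integral => x _ /=.
  by rewrite normc_sqr ger0_norm -!expr2// addr_ge0 ?sqr_ge0.
rewrite f0 => /(_ erefl); apply: filterS => x /= H Dx; move: (H Dx) => [].
move=> /eqP; rewrite paddr_eq0 -?expr2 ?sqr_ge0// !sqrf_eq0 => /andP[/eqP r0 /eqP i0].
by case: (f x) r0 i0 => ? ? /= -> ->.
Qed.

(** A weighted Young inequality in the role of Cauchy-Schwarz; the free weight lets [cvgL2_rip]
    absorb the norm of its fixed test function. *)
Lemma rip_bound f g (e : R) : 0 < e -> inL2 m D f -> inL2 m D g ->
  `|rip f g| <= e * rip f f + e^-1 * rip g g.
Proof.
move=> e0 fL gL; apply: (le_trans (le_normr_Rintegral mD (rip_integrable fL gL))).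
have iff := rip_integrable fL fL; have igg := rip_integrable gL gL.
rewrite -!RintegralZl// -RintegralD//; [|exact: integrableZl_EFin..].
apply: le_Rintegral => //.
- exact: (integrable_norm (rip_integrable fL gL)).
- by apply: integrableD_EFin => //; exact: integrableZl_EFin.
move=> x _; move: (complex.Re (f x)) (complex.Im (f x)) (complex.Re (g x)) (complex.Im (g x)) => a b u v.
have -> : e * (a * a + b * b) + e^-1 * (u * u + v * v) =
    e^-1 * ((e * a) ^+ 2 + (e * b) ^+ 2 + u ^+ 2 + v ^+ 2) by field; rewrite gt_eqF.
have -> : a * u + b * v = e^-1 * (e * a * u + e * b * v) by field; rewrite gt_eqF.
rewrite normrM gtr0_norm ?invr_gt0// ler_pM2l ?invr_gt0//.
move: (e * a) (e * b) => p q; rewrite ler_norml.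
have := sqr_ge0 (p + u); have := sqr_ge0 (p - u).
have := sqr_ge0 (q + v); have := sqr_ge0 (q - v).
have := sqr_ge0 p; have := sqr_ge0 q; have := sqr_ge0 u; have := sqr_ge0 v.
by move=> *; apply/andP; split; nra.
Qed.

Lemma ae_eq_rip f g h : cmeasurable D f -> cmeasurable D g -> cmeasurable D h ->
  ae_eq m D g h -> rip f g = rip f h.
Proof.
move=> [f1 f2] [g1 g2] [h1 h2] gh; congr fine; apply: ae_eq_integral => //.
- by apply/measurable_EFinP; apply: measurable_funD; exact: measurable_funM.
- by apply/measurable_EFinP; apply: measurable_funD; exact: measurable_funM.
- by apply: filterS gh => x /= H Dx; rewrite H.
Qed.

Lemma cvgL2_rip (u : nat -> T -> R[i]) f h : (forall n, cmeasurable D (u n)) ->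
  inL2 m D f -> inL2 m D h -> cvgL2 m D u \oo f ->
  rip h (u n) @[n --> \oo] --> rip h f.
Proof.
move=> mu_ fL hL uf; apply/cvgrPdist_le => /= e e0.
pose k := rip h h; have k0 : 0 <= k by exact: rip_ge0.
(* Weight for [rip_bound]: c k <= e/2, with k + 1 in the denominator because k may be 0. The
   threshold (e/2) c below then makes the second term at most e/2. *)
pose c := e / 2 / (k + 1); have c0 : 0 < c by rewrite !divr_gt0// ltr_wpDl.
have s0 : (0 < (e / 2 * c)%:E)%E by rewrite lte_fin mulr_gt0// divr_gt0.
have : \forall n \near \oo, (sqnormL2 m D (fun x => (u n x - f x)%R) < (e / 2 * c)%:E)%E.
  by apply: (uf [set y | (y < (e / 2 * c)%:E)%E]); apply: open_nbhs_nbhs; split => //; exact: open_ereal_lt_ereal.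
apply: filterS => n un.
(* The [u n] are only known to be measurable; finite distance to [f] puts [u n] in L^2 for large
   [n]. *)
have dL : inL2 m D (fun x => u n x - f x).
  split; last by rewrite (lt_trans un)// ltry.
  have [u1 u2] := mu_ n; have [[f1 f2] _] := fL.
  by split; under eq_fun do rewrite raddfB; exact: measurable_funB.
have uL : inL2 m D (u n).
  have := inL2D dL fL; congr inL2; apply/funext => x; exact: subrK.
rewrite distrC -ripBr//; apply: (le_trans (rip_bound c0 hL dL)).
move: un; rewrite sqnormL2_rip// lte_fin => un.
have -> : e = e / 2 + c^-1 * (e / 2 * c) by field; rewrite gt_eqF.
apply: lerD; last by apply: ler_wpM2l; rewrite ?invr_ge0 ltW.
rewrite -/k /c mulrAC ler_pdivrMr ?ltr_wpDl// ler_wpM2l ?divr_ge0 ?(ltW e0)//.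
by rewrite lerDl.
Qed.

End ComplexL2.
(** * Lebesgue measure under translations, densities and truncations *)

Section Translation.
Context (R : realType).
Local Notation mu := (@lebesgue_measure R).

Lemma lebesgue_measure_shift (s : R) (A : set R) : measurable A ->
  pushforward mu (fun x : R => x + s : measurableTypeR R) A = mu A.
Proof.
move=> mA.
have ms : measurable_fun [set: R] (fun x : R => x + s : measurableTypeR R).
  exact: measurable_funD.
pose nu := pushforward mu (fun x : R => x + s : measurableTypeR R).
apply/esym/(@lebesgue_measure_unique _ nu) => //= _ [[a b]] _ <-.
rewrite /nu /pushforward.
have -> : (fun x : R => x + s) @^-1` `]a, b]%classic = `]a - s, b - s]%classic.
  by apply/seteqP; split => x /=; rewrite !in_itv/= ltrBlDr lerBrDr.
rewrite !lebesgue_measure_itv/= !lte_fin ltrD2r.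
by case: ifPn => // _; congr EFin; ring.
Qed.

Lemma ge0_integral_shift (s : R) (f : R -> \bar R) : measurable_fun setT f ->
  (forall x, (0 <= f x)%E) ->
  (\int[mu]_x f (x + s)%R = \int[mu]_x f x)%E.
Proof.
move=> mf f0.
have ms : measurable_fun [set: R] (fun x : R => x + s : measurableTypeR R).
  exact: measurable_funD.
have := @ge0_integral_pushforward _ _ (measurableTypeR R) (measurableTypeR R) R _ ms mu setT f measurableT mf (fun y _ => f0 y).
rewrite preimage_setT => /esym e; rewrite [LHS]e.
by apply: eq_measure_integral => A mA _; exact: lebesgue_measure_shift.
Qed.

Lemma Rintegral_shift (s : R) (f : R -> R) : mu.-integrable setT (EFin \o f) ->
  \int[mu]_x f (x + s) = \int[mu]_x f x.
Proof.
move=> jf; congr fine; have mf := measurable_int _ jf.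
rewrite integralE [RHS]integralE.
congr (_ - _)%E.
  rewrite -(@ge0_integral_shift s _ (measurable_funepos mf) (funepos_ge0 _)).
  by apply: eq_integral => x _; rewrite !funeposE.
rewrite -(@ge0_integral_shift s _ (measurable_funeneg mf) (funeneg_ge0 _)).
by apply: eq_integral => x _; rewrite !funenegE.
Qed.

Lemma integrable_shift (s : R) (f : R -> R) : mu.-integrable setT (EFin \o f) ->
  mu.-integrable setT (EFin \o (fun x => f (x + s))).
Proof.
move=> /integrableP[mf fi]; have mf' : measurable_fun setT f by exact/measurable_EFinP.
apply/integrableP; split.
  by apply/measurable_EFinP; apply: measurableT_comp => //; exact: measurable_funD.
have ma : measurable_fun setT (fun x => `|(f x)%:E|)%E by exact: measurableT_comp.
by rewrite (ge0_integral_shift s ma (fun=> abse_ge0 _)).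
Qed.

End Translation.

Section Density.
Context (R : realType) (F : R -> R) (F0 : forall x, 0 < F x)
  (mF : measurable_fun [set: R] F).
Local Notation mu := (@lebesgue_measure R).
Local Notation sigma := (density_measure F0 mF).

Import HBNNSimple.

(** Holds for indicators by the definition of sigma, for simple functions by linearity, and in
    general by monotone convergence. *)
Lemma integral_density (f : R -> \bar R) : measurable_fun setT f ->
  (forall x, (0 <= f x)%E) ->
  (\int[sigma]_x f x = \int[mu]_x (f x * (F x)%:E))%E.
Proof.
move=> mf f0.
pose f_ := nnsfun_approx measurableT mf.
have mFE : measurable_fun setT (EFin \o F) by exact/measurable_EFinP.
have mf_ n : measurable_fun [set: R] (f_ n : R -> R) by exact: measurable_funPT.
have ndf p q x : (p <= q)%N -> f_ p x <= f_ q x.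
  by move=> pq; exact/lefP/nd_nnsfun_approx.
have f_cvg x : EFin \o f_ ^~ x @ \oo --> f x by exact: cvg_nnsfun_approx.
transitivity (limn (fun n => \int[sigma]_x (f_ n x)%:E)%E).
  rewrite -monotone_convergence//.
  - by apply: eq_integral => x _; apply/esym/cvg_lim => //; exact: f_cvg.
  - by move=> n; apply/measurable_EFinP; exact: mf_.
  - by move=> n y _; rewrite lee_fin.
  - by move=> y _ p q pq; rewrite lee_fin; exact: ndf.
rewrite (_ : (fun n => _) = fun n => (\int[mu]_x ((f_ n x)%:E * (F x)%:E))%E).
  rewrite -monotone_convergence//.
  - apply: eq_integral => x _; apply/cvg_lim => //.
    by apply: cvgeZr => //; exact: f_cvg.
  - move=> n; apply: emeasurable_funM => //; apply/measurable_EFinP; exact: mf_.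
  - by move=> n y _; rewrite mule_ge0// lee_fin// ltW.
  - move=> y _ p q pq; rewrite lee_wpmul2r// lee_fin; first exact: ltW.
    exact: ndf.
apply/funext => n.
have mA k : measurable (f_ n @^-1` [set k] : set R).
  by rewrite -[X in measurable X]setTI; exact: mf_.
have mI k : measurable_fun [set: R] (\1_(f_ n @^-1` [set k]) : R -> R).
  exact: measurable_indic.
have mkI k : measurable_fun [set: R] (fun x => k * \1_(f_ n @^-1` [set k]) x : R).
  exact: measurable_funM.
transitivity (\sum_(k \in range (f_ n)) \int[sigma]_x (k * \1_(f_ n @^-1` [set k]) x)%:E)%E.
  under eq_integral do rewrite fimfunE -fsumEFin//.
  rewrite ge0_integral_fsum//.
  - by move=> y; apply/measurable_EFinP; exact: mkI.
  - by move=> y x _; rewrite nnfun_muleindic_ge0.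
transitivity (\sum_(k \in range (f_ n)) \int[mu]_x ((k * \1_(f_ n @^-1` [set k]) x)%:E * (F x)%:E))%E.
  apply: eq_fsbigr => r; rewrite inE => -[x0 _ <-].
  have r0 : 0 <= f_ n x0 by [].
  under eq_integral do rewrite EFinM.
  rewrite ge0_integralZl_EFin//; last by apply/measurable_EFinP; exact: mI.
  rewrite integral_indic//; last exact: mA.
  under [RHS]eq_integral do rewrite EFinM -muleA.
  rewrite ge0_integralZl_EFin//; last 2 first.
  - by move=> x _; rewrite mule_ge0// lee_fin// ltW.
  - by apply: emeasurable_funM => //; apply/measurable_EFinP; exact: mI.
  congr (_ * _)%E; rewrite setIT /density_measure [LHS]integral_mkcond.
  apply: eq_integral => x _; rewrite /patch indicE.
  by case: (_ \in _); rewrite ?mul1e ?mul0e.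
transitivity (\int[mu]_x (\sum_(k \in range (f_ n))
    ((k * \1_(f_ n @^-1` [set k]) x)%:E * (F x)%:E)))%E.
  rewrite ge0_integral_fsum//.
  - by move=> r; apply: emeasurable_funM => //; apply/measurable_EFinP; exact: mkI.
  - move=> r x _; rewrite mule_ge0//; first exact: nnfun_muleindic_ge0.
    by rewrite lee_fin ltW.
apply: eq_integral => x _; rewrite -ge0_mule_fsuml.
  by rewrite fsumEFin// -fimfunE.
by move=> k; exact: nnfun_muleindic_ge0.
Qed.

(** Strict positivity of [F] is what makes the null sets agree: a zero integral of [F] over N forces
    N to be Lebesgue-null. *)
Lemma ae_density (P : R -> Prop) : {ae sigma, forall x, P x} <-> {ae mu, forall x, P x}.
Proof.
split=> -[N [mN N0 PN]]; exists N; split => //.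
  have : (\int[mu]_(x in N) `|(F x)%:E| = 0)%E.
    rewrite -[RHS]N0; apply: eq_integral => x _.
    by rewrite gee0_abs// lee_fin ltW.
  have mFN : measurable_fun N (EFin \o F).
    by apply/measurable_EFinP; exact: measurable_funS mF.
  move=> /(ae_eq_integral_abs mu mN mFN)[M [mM M0 NM]].
  apply: (@subset_measure0 _ _ _ _ N M) => //.
  move=> x Nx; apply: NM => /= /(_ Nx) [].
  by move/eqP; rewrite gt_eqF.
rewrite -[LHS]/(\int[mu]_(x in N) (EFin \o F) x)%E.
by apply: null_set_integral => //; apply/measurable_EFinP; exact: measurable_funS mF.
Qed.

Lemma integrable_density (f : R -> R) : measurable_fun setT f ->
  sigma.-integrable setT (EFin \o f) <->
  mu.-integrable setT (EFin \o (fun x => f x * F x)).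
Proof.
move=> mf.
have e : (\int[sigma]_x `|(f x)%:E| = \int[mu]_x `|(f x * F x)%:E|)%E.
  rewrite integral_density//.
    apply: eq_integral => x _ /=; rewrite normrM EFinM.
    by rewrite [`|F x|]ger0_norm// ltW.
  by apply: measurableT_comp => //; exact/measurable_EFinP.
split=> /integrableP[_ i]; apply/integrableP; split.
- by apply/measurable_EFinP; exact: measurable_funM.
- by rewrite -e.
- exact/measurable_EFinP.
- by rewrite e.
Qed.

Lemma Rintegral_density (f : R -> R) : sigma.-integrable setT (EFin \o f) ->
  \int[sigma]_x f x = \int[mu]_x (f x * F x).
Proof.
move=> jf; congr fine.
have mf : measurable_fun setT (EFin \o f) := measurable_int _ jf.
rewrite integralE [RHS]integralE.
rewrite !integral_density//.
- congr (_ - _)%E; apply: eq_integral => x _.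
    by rewrite !funeposE -!EFin_max -EFinM maxr_pMl ?mul0r// ltW.
  by rewrite !funenegE -!EFinN -!EFin_max -EFinM maxr_pMl ?mul0r ?mulNr// ltW.
- exact: measurable_funeneg.
- exact: measurable_funepos.
Qed.

End Density.

Section Windows.
Context (R : realType) (m : {measure set (measurableTypeR R) -> \bar R}).
Local Notation window N := (`[- (N%:R : R), N%:R]%classic : set R).

Lemma measurable_window N : measurable (window N).
Proof. exact: measurable_itv. Qed.

Lemma window_near (x : R) : \forall N \near \oo, window N x.
Proof.
near=> N; rewrite /= in_itv/= -ler_norml; near: N; exact: nbhs_infty_ger.
Unshelve. all: by end_near. Qed.

Lemma Rintegral_window_cvg (D : set R) (f : R -> R) : measurable D ->
  m.-integrable D (EFin \o f) ->
  \int[m]_(x in D `&` window N) f x @[N --> \oo] --> \int[m]_(x in D) f x.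
Proof.
move=> mD jf; under eq_fun do rewrite Rintegral_mkcondr.
have mf : measurable_fun D f by apply/measurable_EFinP; exact: measurable_int jf.
apply: (@Rintegral_dominated_cvg _ _ _ m D mD (fun N => f \_ (window N)) f (fun x => `|f x|)) => //.
- move=> N; apply/measurable_restrict => //.
  by apply: measurable_funS mf.
- move=> x Dx; apply: cvg_near_cst; apply: filterS (window_near x) => N wx.
  by rewrite patchE mem_set.
- exact: integrable_norm.
- by move=> N x Dx; rewrite patchE/=; case: ifP => // _; rewrite normr0.
Qed.
End Windows.
(** * The truncated transform and its adjoint *)

Section Parametric.
Context (R : realType).
Local Notation mu := (@lebesgue_measure R).
Implicit Types (phi : R * R -> R) (a b : R -> R).

(** No integrability is involved: the extended integral is a difference of two Tonelli integrals,
    and [fine], which sends infinities to 0, is measurable. *)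
Lemma measurable_Rintegral_fst phi : measurable_fun setT phi ->
  measurable_fun [set: R] (fun x => \int[mu]_y phi (x, y)).
Proof.
move=> mphi; have mE : measurable_fun setT (EFin \o phi) by exact/measurable_EFinP.
apply: measurableT_comp; first exact: (fine_measurable measurableT).
rewrite (_ : (fun x => _) = fun x =>
  (\int[mu]_y (EFin \o phi)^\+ (x, y) - \int[mu]_y (EFin \o phi)^\- (x, y))%E).
  apply: emeasurable_funB.
    apply: measurable_fun_fubini_tonelli_F; [exact: measurable_funepos|exact: funepos_ge0].
  apply: measurable_fun_fubini_tonelli_F; [exact: measurable_funeneg|exact: funeneg_ge0].
apply/funext => x; rewrite integralE.
by congr (_ - _)%E; apply: eq_integral => y _; rewrite ?funeposE ?funenegE.
Qed.

Lemma measurable_Rintegral_snd phi : measurable_fun setT phi ->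
  measurable_fun [set: R] (fun y => \int[mu]_x phi (x, y)).
Proof.
move=> mphi.
apply: (@measurable_Rintegral_fst (fun p => phi (p.2, p.1))).
by apply: measurableT_comp => //; exact: measurable_fun_pair.
Qed.

Lemma integrable_fst phi a b x : measurable_fun setT phi ->
  mu.-integrable setT (EFin \o b) ->
  (forall y, `|phi (x, y)| <= a x * b y) ->
  mu.-integrable setT (EFin \o (fun y => phi (x, y))).
Proof.
move=> mphi ib phiab; apply: le_integrable (integrableZl_EFin _ (a x) ib) => //.
  by apply/measurable_EFinP; apply: measurableT_comp => //; exact: pair1_measurable.
by move=> y _; rewrite lee_fin (le_trans (phiab y))// ler_norm.
Qed.

(** A majorant in product form gives integrability on the plane and on every section, not just
    almost every one, so that [fine] loses nothing in the inner integrals. *)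
Lemma Rintegral_Fubini phi a b : measurable_fun setT phi ->
  mu.-integrable setT (EFin \o a) -> mu.-integrable setT (EFin \o b) ->
  (forall x y, `|phi (x, y)| <= a x * b y) ->
  \int[mu]_x (\int[mu]_y phi (x, y)) = \int[mu]_y (\int[mu]_x phi (x, y)).
Proof.
move=> mphi ia ib phiab.
have mE : measurable_fun setT (EFin \o phi) by exact/measurable_EFinP.
have i12 : (mu \x mu)%E.-integrable setT (EFin \o phi).
  apply: (iffRL (@integrable12ltyP _ _ _ _ _ mu mu _ mE)).
  apply: (@le_lt_trans _ _ (\int[mu]_x (`|a x|%:E * \int[mu]_y (`|b y|)%:E))%E).
    apply: ge0_le_integral => //.
    - by move=> x _; apply: integral_ge0.
    - have mA : measurable_fun setT (abse \o (EFin \o phi)) by exact: measurableT_comp.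
      by apply: (@measurable_fun_fubini_tonelli_F _ _ _ _ _ mu (abse \o (EFin \o phi))) => // p; exact: abse_ge0.
    - apply: emeasurable_funM => //; apply/measurable_EFinP; apply: measurableT_comp => //.
      by apply/measurable_EFinP; exact: measurable_int ia.
    - move=> x _; rewrite -ge0_integralZl//; last first.
        apply/measurable_EFinP; apply: measurableT_comp => //.
        by apply/measurable_EFinP; exact: measurable_int ib.
      apply: ge0_le_integral => //.
      - by apply: measurableT_comp => //; apply: measurableT_comp => //; exact: pair1_measurable.
      - apply: emeasurable_funM => //; apply/measurable_EFinP; apply: measurableT_comp => //.
        by apply/measurable_EFinP; exact: measurable_int ib.
      - by move=> y _; rewrite -EFinM lee_fin -normrM (le_trans (phiab x y))// ler_norm.
  have /integrableP[_ fa] := ia; have /integrableP[_ fb] := ib.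
  have ib' : (\int[mu]_y (`|b y|)%:E)%E \is a fin_num.
    by rewrite ge0_fin_numE ?integral_ge0//.
  rewrite ge0_integralZr//.
  - by rewrite muleC lte_mul_pinfty ?integral_ge0.
  - apply/measurable_EFinP; apply: measurableT_comp => //.
    by apply/measurable_EFinP; exact: measurable_int ia.
  - exact: integral_ge0.
congr fine.
transitivity (\int[mu]_x \int[mu]_y (EFin \o phi) (x, y))%E.
  apply: eq_integral => x _; rewrite fineK//.
  exact: integrable_fin_num (integrable_fst mphi ib (phiab x)).
rewrite (Fubini i12); apply: eq_integral => y _; rewrite fineK//.
apply: integrable_fin_num => //.
apply: (@integrable_fst (fun p => phi (p.2, p.1)) b a) => //.
  by apply: measurableT_comp => //; exact: measurable_fun_pair.
by move=> x; rewrite mulrC.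
Qed.

End Parametric.

Section ComplexIntegral.
Context d (T : measurableType d) (R : realType).
Variables (m : {measure set T -> \bar R}) (D : set T).
Hypothesis mD : measurable D.

Lemma Re_mul_cintegral (z : R[i]) (h : T -> R[i]) :
  m.-integrable D (EFin \o (fun x => complex.Re (h x))) ->
  m.-integrable D (EFin \o (fun x => complex.Im (h x))) ->
  complex.Re (z * cintegral m D h) = \int[m]_(x in D) complex.Re (z * h x).
Proof.
case: z => a b i1 i2 /=; rewrite -!RintegralZl// -RintegralB//.
- by apply: eq_Rintegral => x _; case: (h x).
- exact: integrableZl_EFin.
- exact: integrableZl_EFin.
Qed.

Lemma cintegral_conj (h : T -> R[i]) :
  m.-integrable D (EFin \o (fun x => complex.Im (h x))) ->
  conjc (cintegral m D h) = cintegral m D (fun x => conjc (h x)).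
Proof.
move=> ih; rewrite /cintegral/=; congr Complex.
  by apply: eq_Rintegral => x _; case: (h x).
rewrite -mulN1r -RintegralZl//; apply: eq_Rintegral => x _.
by rewrite mulN1r; case: (h x).
Qed.

End ComplexIntegral.

(** * Duality of truncated transform and truncated synthesis *)

Section KernelTransform.
Context (R : realType) (D : set R) (psi : R -> R -> R[i]) (G : R -> R).
Context (F : R -> R) (F0 : forall x, 0 < F x) (mF : measurable_fun [set: R] F).
Local Notation mu := (@lebesgue_measure R).
Local Notation sigma := (density_measure F0 mF).
Local Notation window N := (`[- (N%:R : R), N%:R]%classic : set R).
Hypothesis mD : measurable D.
(** Joint measurability is stated for the kernel extended by 0 off [D], so that the parametric
    integrals can be taken over the whole line. *)
Hypothesis mpsi_Re :
  measurable_fun setT (fun p : R * R => \1_D p.1 * complex.Re (psi p.2 p.1)).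
Hypothesis mpsi_Im :
  measurable_fun setT (fun p : R * R => \1_D p.1 * complex.Im (psi p.2 p.1)).
Hypothesis psi_Re_le : forall lambda x, D x -> `|complex.Re (psi lambda x)| <= G lambda.
Hypothesis psi_Im_le : forall lambda x, D x -> `|complex.Im (psi lambda x)| <= G lambda.
Hypothesis G_ge0 : forall lambda, 0 <= G lambda.
(** Only local square integrability is available: [G] will be the sum over k of |Re A_k| + |Im A_k|,
    controlled on bounded windows by [coefficient_sqint]. *)
Hypothesis G_sqint : forall N, sqint sigma setT (fun lambda => \1_(window N) lambda * G lambda).

Definition truncated_transform (M : nat) (f : R -> R[i]) (lambda : R) :=
  innerL2 mu (D `&` window M) (psi lambda) f.

Definition truncated_synthesis (N : nat) (g : R -> R[i]) (x : R) :=
  cintegral mu (window N) (fun lambda => g lambda * psi lambda x * (F lambda)%:C%C).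

Lemma Rintegral_indic_mul (E : set R) (h : R -> R) :
  \int[mu]_(x in E) h x = \int[mu]_x (\1_E x * h x).
Proof.
rewrite Rintegral_mkcond; apply: eq_Rintegral => x _.
by rewrite patchE indicE; case: (_ \in _); rewrite ?mul1r ?mul0r.
Qed.

Lemma measurable_indic_mul (E D' : set R) (h : R -> R) : measurable E -> measurable D' -> E `<=` D' ->
  measurable_fun D' h -> measurable_fun setT (fun x => \1_E x * h x).
Proof.
move=> mE mD' ED mh; rewrite (_ : (fun x => _) = h \_ E).
  by apply/(measurable_restrictT _ mE); exact: (measurable_funS mD' ED).
by apply/funext => x; rewrite patchE indicE; case: (_ \in _); rewrite ?mul1r ?mul0r.
Qed.

Let DM M := D `&` window M.

Let mDM M : measurable (DM M).
Proof. by apply: measurableI => //; exact: measurable_window. Qed.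

Let DMD M : DM M `<=` D. Proof. by move=> x []. Qed.

Lemma measurable_fst_comp (h : R -> R) : measurable_fun setT h ->
  measurable_fun setT (fun p : R * R => h p.1).
Proof. by move=> mh; apply: measurableT_comp. Qed.

Lemma measurable_snd_comp (h : R -> R) : measurable_fun setT h ->
  measurable_fun setT (fun p : R * R => h p.2).
Proof. by move=> mh; apply: measurableT_comp. Qed.

Lemma cmeasurable_truncated_transform M f : cmeasurable D f ->
  cmeasurable setT (truncated_transform M f).
Proof.
move=> [m1 m2].
have n1 := measurable_fst_comp (measurable_indic_mul (mDM M) mD (@DMD M) m1).
have n2 := measurable_fst_comp (measurable_indic_mul (mDM M) mD (@DMD M) m2).
(* The redundant indicator of [D] is attached to the kernel, which thus appears in its jointly
   measurable form. *)
have iDM x : \1_(DM M) x = \1_(DM M) x * \1_D x :> R.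
  rewrite !indicE; case: (boolP (x \in DM M)) => [/set_mem[Dx _]|_].
    by rewrite mem_set// mulr1.
  by rewrite mul0r.
split.
- rewrite (_ : (fun _ => _) = fun lambda => \int[mu]_x
    ((\1_D x * complex.Re (psi lambda x)) * (\1_(DM M) x * complex.Re (f x)) +
     (\1_D x * complex.Im (psi lambda x)) * (\1_(DM M) x * complex.Im (f x)))).
    apply: (@measurable_Rintegral_snd _ (fun p : R * R =>
     (\1_D p.1 * complex.Re (psi p.2 p.1)) * (\1_(DM M) p.1 * complex.Re (f p.1)) +
     (\1_D p.1 * complex.Im (psi p.2 p.1)) * (\1_(DM M) p.1 * complex.Im (f p.1)))).
    by apply: measurable_funD; apply: measurable_funM.
  apply/funext => lambda /=; rewrite Rintegral_indic_mul; apply: eq_Rintegral => x _.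
  by rewrite Re_conjcM [in LHS]iDM; ring.
- rewrite (_ : (fun _ => _) = fun lambda => \int[mu]_x
    ((\1_D x * complex.Re (psi lambda x)) * (\1_(DM M) x * complex.Im (f x)) -
     (\1_D x * complex.Im (psi lambda x)) * (\1_(DM M) x * complex.Re (f x)))).
    apply: (@measurable_Rintegral_snd _ (fun p : R * R =>
     (\1_D p.1 * complex.Re (psi p.2 p.1)) * (\1_(DM M) p.1 * complex.Im (f p.1)) -
     (\1_D p.1 * complex.Im (psi p.2 p.1)) * (\1_(DM M) p.1 * complex.Re (f p.1)))).
    by apply: measurable_funB; apply: measurable_funM.
  apply/funext => lambda /=; rewrite Rintegral_indic_mul; apply: eq_Rintegral => x _.
  by rewrite [in LHS]iDM; case: (psi lambda x) => a b; case: (f x) => u v /=; ring.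
Qed.

Lemma Re_synthesis (g z : R[i]) (c : R) : complex.Re (g * z * c%:C%C) =
  (complex.Re g * complex.Re z - complex.Im g * complex.Im z) * c.
Proof. by case: g z => a b [u v] /=; ring. Qed.

Lemma Im_synthesis (g z : R[i]) (c : R) : complex.Im (g * z * c%:C%C) =
  (complex.Re g * complex.Im z + complex.Im g * complex.Re z) * c.
Proof. by case: g z => a b [u v] /=; ring. Qed.

Lemma cmeasurable_truncated_synthesis N g : cmeasurable setT g ->
  cmeasurable D (truncated_synthesis N g).
Proof.
move=> [m1 m2].
have n1 := measurable_snd_comp m1; have n2 := measurable_snd_comp m2.
have mw : measurable_fun setT (fun l => \1_(window N) l * F l).
  exact: (measurable_indic_mul (D' := setT)).
have n3 := measurable_snd_comp mw.
split.
- apply: (@eq_measurable_fun _ _ _ _ D (fun x => \int[mu]_l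
    ((complex.Re (g l) * (\1_D x * complex.Re (psi l x)) - complex.Im (g l) * (\1_D x * complex.Im (psi l x)))
      * (\1_(window N) l * F l)))).
    move=> x /set_mem Dx; rewrite /= [RHS]Rintegral_indic_mul; apply: eq_Rintegral => l _.
    by rewrite Re_synthesis indicE mem_set// !mul1r; ring.
  apply: measurable_funTS.
  apply: (@measurable_Rintegral_fst _ (fun p : R * R =>
    ((complex.Re (g p.2) * (\1_D p.1 * complex.Re (psi p.2 p.1)) - complex.Im (g p.2) * (\1_D p.1 * complex.Im (psi p.2 p.1)))
      * (\1_(window N) p.2 * F p.2)))).
  by apply: measurable_funM => //; apply: measurable_funB; apply: measurable_funM.
- apply: (@eq_measurable_fun _ _ _ _ D (fun x => \int[mu]_l
    ((complex.Re (g l) * (\1_D x * complex.Im (psi l x)) + complex.Im (g l) * (\1_D x * complex.Re (psi l x)))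
      * (\1_(window N) l * F l)))).
    move=> x /set_mem Dx; rewrite /= [RHS]Rintegral_indic_mul; apply: eq_Rintegral => l _.
    by rewrite Im_synthesis indicE mem_set// !mul1r; ring.
  apply: measurable_funTS.
  apply: (@measurable_Rintegral_fst _ (fun p : R * R =>
    ((complex.Re (g p.2) * (\1_D p.1 * complex.Im (psi p.2 p.1)) + complex.Im (g p.2) * (\1_D p.1 * complex.Re (psi p.2 p.1)))
      * (\1_(window N) p.2 * F p.2)))).
  by apply: measurable_funM => //; apply: measurable_funD; apply: measurable_funM.
Qed.

Lemma sqint_window M : sqint mu D (\1_(window M) : R -> R).
Proof.
split; first by apply: measurable_funTS; apply: measurable_indic; exact: measurable_window.
have iw : mu.-integrable setT (EFin \o (\1_(window M) : R -> R)).
  exact: integrable_indic_itv.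
have iwD : mu.-integrable D (EFin \o (\1_(window M) : R -> R)).
  by apply: (integrableS measurableT).
apply: eq_integrable iwD => // x _ /=.
by rewrite indicE; case: (_ \in _); rewrite ?expr1n ?expr0n.
Qed.

Lemma integrable_indic_mul (E : set R) (h : R -> R) : measurable E ->
  mu.-integrable E (EFin \o h) -> mu.-integrable setT (EFin \o (fun x => \1_E x * h x)).
Proof.
move=> mE ih; have [+ _] := @integrable_mkcond _ (measurableTypeR R) R mu E (EFin \o h) mE.
move=> /(_ ih).
apply: eq_integrable => // x _; rewrite patchE /= indicE.
by case: (_ \in _); rewrite ?mul1r ?mul0r.
Qed.

(** On a bounded window L^2 is contained in L^1: pair with the indicator of the window, which is
    itself square integrable. *)
Lemma integrable_truncation M (h : R -> R) : sqint mu D h ->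
  mu.-integrable setT (EFin \o (fun x => \1_(DM M) x * `|h x|)).
Proof.
move=> hs.
have := integrable_norm (@sqint_mul _ (measurableTypeR R) R mu D mD _ _ (sqint_window M) hs).
move=> /(integrable_indic_mul mD); apply: eq_integrable => // x _ /=.
congr EFin; rewrite normrM mulrA; congr (_ * _).
by rewrite /DM !indicE in_setI; case: (x \in D); case: (x \in _);
  rewrite ?(mul1r, mul0r, normr1, normr0).
Qed.

(** The factor in lambda of the majorant for Fubini: a product of two functions in L^2(sigma), moved
    to Lebesgue measure by the density. *)
Lemma integrable_dominated_synthesis N g : inL2 sigma setT g ->
  mu.-integrable setT (EFin \o (fun l => (`|complex.Re (g l)| + `|complex.Im (g l)|) *
    (\1_(window N) l * G l * F l))).
Proof.
move=> /(inL2P sigma measurableT) [g1 g2].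
have j1 := integrable_norm (sqint_mul measurableT g1 (G_sqint N)).
have j2 := integrable_norm (sqint_mul measurableT g2 (G_sqint N)).
have m1 := measurable_int _ j1; have m2 := measurable_int _ j2.
have j := integrableD_EFin measurableT j1 j2.
have mj : measurable_fun setT (fun l => `|complex.Re (g l) * (\1_(window N) l * G l)|
    + `|complex.Im (g l) * (\1_(window N) l * G l)|).
  by apply/measurable_EFinP; exact: measurable_int j.
have := (iffLR (integrable_density F0 mF mj)) j.
apply: eq_integrable => // l _ /=; congr EFin.
have w0 : 0 <= \1_(window N) l * G l by rewrite mulr_ge0.
by rewrite !normrM -(normrM (\1_(window N) l)) (ger0_norm w0); ring.
Qed.

(** Both sides are iterated integrals of one function [phi] on the plane. The window M makes f
    integrable in x, the window N makes g G F integrable in lambda, and the product of the two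
    majorants dominates [phi]. *)
Lemma kernel_Fubini f g N M : inL2 mu D f -> inL2 sigma setT g ->
  inL2 sigma setT (truncated_transform M f) ->
  \int[mu]_(x in D `&` window M) complex.Re (conjc (f x) * truncated_synthesis N g x) =
  \int[sigma]_(l in window N) complex.Re (conjc (truncated_transform M f l) * g l).
Proof.
move=> fL gL TL.
have [f1 f2] := (iffLR (inL2P mu mD f)) fL.
have mDM' : @measurable _ (measurableTypeR R) (DM M) := mDM M.
have [[mf1 mf2] _] := fL; have [[mg1 mg2] _] := gL.
pose w l := \1_(window N) l * F l : R.
pose fr x := \1_(DM M) x * complex.Re (f x).
pose fi x := \1_(DM M) x * complex.Im (f x).
pose kr (p : R * R) := \1_D p.1 * complex.Re (psi p.2 p.1).
pose ki (p : R * R) := \1_D p.1 * complex.Im (psi p.2 p.1).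
(* The real part of conj(f(x)) g(lambda) psi_lambda(x) F(lambda), cut off to both windows. *)
pose phi (p : R * R) :=
  (fr p.1 * (complex.Re (g p.2) * kr p - complex.Im (g p.2) * ki p) +
   fi p.1 * (complex.Re (g p.2) * ki p + complex.Im (g p.2) * kr p)) * w p.2.
have mphi : measurable_fun setT phi.
  have n1 := measurable_fst_comp (measurable_indic_mul (mDM M) mD (@DMD M) mf1).
  have n2 := measurable_fst_comp (measurable_indic_mul (mDM M) mD (@DMD M) mf2).
  have n3 := measurable_snd_comp mg1; have n4 := measurable_snd_comp mg2.
  have mw : measurable_fun setT w by exact: (measurable_indic_mul (D' := setT)).
  have n5 := measurable_snd_comp mw.
  by apply: measurable_funM => //; apply: measurable_funD; apply: measurable_funM => //;
    [apply: measurable_funB | apply: measurable_funD]; apply: measurable_funM.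
pose a x := \1_(DM M) x * `|complex.Re (f x)| + \1_(DM M) x * `|complex.Im (f x)|.
pose b l := (`|complex.Re (g l)| + `|complex.Im (g l)|) * (\1_(window N) l * G l * F l).
have ia : mu.-integrable setT (EFin \o a).
  by apply: integrableD_EFin => //; exact: integrable_truncation.
have ib : mu.-integrable setT (EFin \o b) by exact: integrable_dominated_synthesis.
have i01 E x : 0 <= \1_E x :> R by [].
have krG x l : `|kr (x, l)| <= G l.
  rewrite /kr /= indicE; case: (boolP (x \in D)) => [/set_mem Dx|_].
    by rewrite mul1r psi_Re_le.
  by rewrite mul0r normr0.
have kiG x l : `|ki (x, l)| <= G l.
  rewrite /ki /= indicE; case: (boolP (x \in D)) => [/set_mem Dx|_].
    by rewrite mul1r psi_Im_le.
  by rewrite mul0r normr0.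
have mulK u v x l : `|u| <= G l -> `|v| <= G l ->
    `|complex.Re (g l) * u| + `|complex.Im (g l) * v| <=
    (`|complex.Re (g l)| + `|complex.Im (g l)|) * G l + 0 * x.
  move=> uG vG; rewrite mul0r addr0 mulrDl !normrM.
  by apply: lerD; apply: ler_wpM2l.
have phiab x l : `|phi (x, l)| <= a x * b l.
  have -> : a x * b l = (`|fr x| * ((`|complex.Re (g l)| + `|complex.Im (g l)|) * G l) +
     `|fi x| * ((`|complex.Re (g l)| + `|complex.Im (g l)|) * G l)) * w l.
    by rewrite /a /b /fr /fi /w !normrM [`|\1_(DM M) x|]ger0_norm//; ring.
  rewrite /phi /= normrM [`|w l|]ger0_norm; last by rewrite mulr_ge0// ltW.
  apply: ler_wpM2r; first by rewrite mulr_ge0// ltW.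
  apply: (le_trans (ler_normD _ _)); rewrite !normrM; apply: lerD; apply: ler_wpM2l => //.
    rewrite (le_trans (ler_normB _ _))//.
    by have := mulK _ _ 0 l (krG x l) (kiG x l); rewrite mulr0 addr0.
  rewrite (le_trans (ler_normD _ _))//.
  by have := mulK _ _ 0 l (kiG x l) (krG x l); rewrite mulr0 addr0.
(* Integrating [phi] over lambda first produces the synthesis; integrating over x first, in [e2],
   produces the conjugate of the transform. *)
have e1 x : \int[mu]_l phi (x, l) =
    \1_(DM M) x * complex.Re (conjc (f x) * truncated_synthesis N g x).
  rewrite indicE; case: (boolP (x \in DM M)) => [xDM|xDM]; last first.
    rewrite mul0r; transitivity (\int[mu]_(l in setT) (0 : R)).
      by apply: eq_Rintegral => l _; rewrite /phi /fr /fi indicE (negbTE xDM) /=; ring.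
    by rewrite Rintegral_cst ?mul0r.
  have /set_mem[Dx _] := xDM.
  have iDx : \1_D x = 1 :> R by rewrite indicE mem_set.
  have mx1 : measurable_fun setT (fun l => complex.Re (psi l x)).
    have := measurableT_comp mpsi_Re (pair1_measurable x).
    by apply: eq_measurable_fun => l _ /=; rewrite iDx mul1r.
  have mx2 : measurable_fun setT (fun l => complex.Im (psi l x)).
    have := measurableT_comp mpsi_Im (pair1_measurable x).
    by apply: eq_measurable_fun => l _ /=; rewrite iDx mul1r.
  have ibw : mu.-integrable (window N) (EFin \o b).
    by apply: (integrableS measurableT) => //; exact: measurable_window.
  have bound u v l : window N l -> `|u| <= G l -> `|v| <= G l ->
      (`|complex.Re (g l) * u| + `|complex.Im (g l) * v|) * F l <= b l.
    move=> wl uG vG; rewrite /b indicE mem_set// mul1r mulrA.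
    apply: ler_wpM2r; first exact: ltW.
    by have := mulK _ _ 0 l uG vG; rewrite mulr0 addr0.
  rewrite mul1r Re_mul_cintegral.
  - rewrite [RHS]Rintegral_indic_mul; apply: eq_Rintegral => l _.
    rewrite /phi /fr /fi /kr /ki /w /= iDx indicE xDM.
    by case: (f x) (g l) (psi l x) => ? ? [? ?] [? ?] /=; ring.
  - exact: measurable_window.
  - apply: le_integrable ibw; first exact: measurable_window.
      apply/measurable_EFinP; apply: measurable_funTS.
      under eq_fun do rewrite Re_synthesis.
      by apply: measurable_funM => //; apply: measurable_funB; apply: measurable_funM.
    move=> l wl; rewrite lee_fin Re_synthesis normrM [`|F l|]gtr0_norm//.
    apply: le_trans (ler_norm _); apply: le_trans (bound _ _ _ wl (psi_Re_le _ Dx) (psi_Im_le _ Dx)).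
    by apply: ler_wpM2r; [exact: ltW|exact: ler_normB].
  - apply: le_integrable ibw; first exact: measurable_window.
      apply/measurable_EFinP; apply: measurable_funTS.
      under eq_fun do rewrite Im_synthesis.
      by apply: measurable_funM => //; apply: measurable_funD; apply: measurable_funM.
    move=> l wl; rewrite lee_fin Im_synthesis normrM [`|F l|]gtr0_norm//.
    apply: le_trans (ler_norm _); apply: le_trans (bound _ _ _ wl (psi_Im_le _ Dx) (psi_Re_le _ Dx)).
    by apply: ler_wpM2r; [exact: ltW|exact: ler_normD].
have e2 l : \int[mu]_x phi (x, l) =
    (\1_(window N) l * complex.Re (conjc (truncated_transform M f l) * g l)) * F l.
  have my1 : measurable_fun D (fun x => complex.Re (psi l x)).
    have := measurable_funTS (D := D) (measurableT_comp mpsi_Re (pair2_measurable l)).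
    by apply: eq_measurable_fun => x /set_mem Dx /=; rewrite indicE mem_set// mul1r.
  have my2 : measurable_fun D (fun x => complex.Im (psi l x)).
    have := measurable_funTS (D := D) (measurableT_comp mpsi_Im (pair2_measurable l)).
    by apply: eq_measurable_fun => x /set_mem Dx /=; rewrite indicE mem_set// mul1r.
  have iaD : mu.-integrable (DM M) (EFin \o (fun x => G l * a x)).
    apply: integrableZl_EFin => //.
    exact: (@integrableS _ (measurableTypeR R) R mu setT (DM M) _ measurableT (mDM M) (@subsetT _ _) ia).
  have iRe : mu.-integrable (DM M) (EFin \o (fun x => complex.Re (conjc (psi l x) * f x))).
    apply: le_integrable iaD; first exact: mDM.
      apply/measurable_EFinP; apply: (measurable_funS mD (@DMD M)).
      under eq_fun do rewrite Re_conjcM.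
      by apply: measurable_funD; apply: measurable_funM.
    move=> x DMx; have Dx := DMD DMx; rewrite lee_fin Re_conjcM; apply: le_trans (ler_norm _).
    rewrite /a indicE mem_set// !mul1r (le_trans (ler_normD _ _))// !normrM mulrDr.
    by apply: lerD; apply: ler_wpM2r => //; [exact: psi_Re_le|exact: psi_Im_le].
  have ImE x : complex.Im (conjc (psi l x) * f x) =
      complex.Re (psi l x) * complex.Im (f x) - complex.Im (psi l x) * complex.Re (f x).
    by case: (psi l x) (f x) => ? ? [? ?] /=; ring.
  have iIm : mu.-integrable (DM M) (EFin \o (fun x => complex.Im (conjc (psi l x) * f x))).
    apply: le_integrable iaD; first exact: mDM.
      apply/measurable_EFinP; apply: (measurable_funS mD (@DMD M)).
      under eq_fun do rewrite ImE.
      by apply: measurable_funB; apply: measurable_funM.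
    move=> x DMx; have Dx := DMD DMx; rewrite lee_fin ImE; apply: le_trans (ler_norm _).
    rewrite /a indicE mem_set// !mul1r (le_trans (ler_normB _ _))// !normrM mulrDr addrC.
    by apply: lerD; apply: ler_wpM2r => //; [exact: psi_Im_le|exact: psi_Re_le].
  transitivity (complex.Re ((g l * (w l)%:C%C) * conjc (truncated_transform M f l))).
    rewrite /truncated_transform /innerL2 (@cintegral_conj _ (measurableTypeR R) R mu (DM M) mDM' _ iIm).
    rewrite (@Re_mul_cintegral _ (measurableTypeR R) R mu (DM M) mDM').
    - rewrite [RHS]Rintegral_indic_mul; apply: eq_Rintegral => x _.
      rewrite /phi /fr /fi /kr /ki /= -/(DM M).
      have iDM : \1_(DM M) x = \1_(DM M) x * \1_D x :> R.
        rewrite !indicE; case: (boolP (x \in DM M)) => [/set_mem[Dx _]|_].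
          by rewrite mem_set// mulr1.
        by rewrite mul0r.
      rewrite [in RHS]iDM.
      by case: (f x) (g l) (psi l x) => ? ? [? ?] [? ?] /=; ring.
    - apply: eq_integrable iRe => // x _ /=.
      by case: (psi l x) (f x) => ? ? [? ?].
    - have := @integrableZl_EFin _ (measurableTypeR R) R mu (DM M) mDM' (-1) _ iIm; apply: eq_integrable => // x _ /=.
      by case: (psi l x) (f x) => ? ? [? ?] /=; rewrite mulN1r.
  rewrite /w; case: (truncated_transform M f l) (g l) => ? ? [? ?] /=; ring.
rewrite [LHS]Rintegral_indic_mul.
under eq_Rintegral do rewrite -e1.
rewrite (Rintegral_Fubini mphi ia ib phiab).
under eq_Rintegral do rewrite e2.
have iTg := rip_integrable measurableT TL gL.
have iw : sigma.-integrable setT (EFin \o (fun l => complex.Re (conjc (truncated_transform M f l) * g l) * \1_(window N) l)).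
  have mi : measurable_fun [set: R] (\1_(window N) : R -> R).
    by apply: measurable_indic; exact: measurable_window.
  have i1 l : setT l -> `|\1_(window N) l : R| <= 1.
    by move=> _; rewrite indicE ger0_norm; case: (_ \in _).
  have := @integrable_mul_bounded _ (measurableTypeR R) R sigma setT measurableT _ _ 1 iTg mi i1.
  by apply: eq_integrable => // l _; rewrite /comp Re_conjcM.
rewrite [RHS]Rintegral_mkcond.
transitivity (\int[sigma]_l (complex.Re (conjc (truncated_transform M f l) * g l) * \1_(window N) l)).
  by rewrite Rintegral_density//; apply: eq_Rintegral => l _; congr (_ * _); rewrite mulrC.
by apply: eq_Rintegral => l _; rewrite patchE indicE; case: (_ \in _); rewrite ?mulr1 ?mulr0.
Qed.

End KernelTransform.
(** * Fourier transforms of intervals *)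

Section Exponentials.
Context (R : realType).
Local Notation mu := (@lebesgue_measure R).
Implicit Types (l xi x s c eps : R).

Lemma conjc_e_mul l xi x : conjc (e l x) * e xi x = conjc (e (l - xi) x).
Proof.
rewrite /e /=; have -> : 2 * pi * (l - xi) * x = 2 * pi * l * x - 2 * pi * xi * x by ring.
by apply/eqP; rewrite eq_complex /= cosB sinB; apply/andP; split; apply/eqP; ring.
Qed.

Lemma conjc_eK l x : conjc (e l x) * e l x = 1.
Proof.
rewrite conjc_e_mul subrr /e mulr0 mul0r cos0 sin0 /=.
by apply/eqP; rewrite eq_complex /= oppr0 !eqxx.
Qed.

Lemma e_conjcK l x : e l x * conjc (e l x) = 1.
Proof. by rewrite mulrC conjc_eK. Qed.

Lemma e_addr l x s : e l (x + s) = e l x * e l s.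
Proof.
rewrite /e mulrDr cosD sinD; apply/eqP; rewrite eq_complex /=.
by apply/andP; split; apply/eqP; ring.
Qed.

Lemma measurable_e_pair :
  cmeasurable setT (fun p : R * R => e p.2 p.1).
Proof.
have m : measurable_fun setT (fun p : R * R => 2 * pi * p.2 * p.1).
  by apply: measurable_funM => //; apply: measurable_funM.
split; apply: (measurableT_comp _ m).
  exact: continuous_measurable_fun (@continuous_cos R).
exact: continuous_measurable_fun (@continuous_sin R).
Qed.

Lemma measurable_e_fst l : cmeasurable setT (fun x => e l x).
Proof.
have [m1 m2] := measurable_e_pair.
split.
  exact: (measurableT_comp m1 (pair2_measurable l)).
exact: (measurableT_comp m2 (pair2_measurable l)).
Qed.

Lemma measurable_e_snd x : cmeasurable setT (fun l => e l x).
Proof.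
have [m1 m2] := measurable_e_pair.
split.
  exact: (measurableT_comp m1 (pair1_measurable x)).
exact: (measurableT_comp m2 (pair1_measurable x)).
Qed.

Lemma Re_e_le1 l x : `|complex.Re (e l x)| <= 1.
Proof. exact: cos_max. Qed.

Lemma Im_e_le1 l x : `|complex.Im (e l x)| <= 1.
Proof. exact: sin_max. Qed.

Lemma Re_conjc (z : R[i]) : complex.Re (conjc z) = complex.Re z.
Proof. by case: z. Qed.

Lemma Im_conjc (z : R[i]) : complex.Im (conjc z) = - complex.Im z.
Proof. by case: z. Qed.

Definition itv_transform c eps l : R[i] :=
  cintegral mu `[c, c + eps]%classic (fun x => conjc (e l x)).

Lemma mitv c eps : @measurable _ (measurableTypeR R) (`[c, c + eps]%classic : set R).
Proof. exact: measurable_itv. Qed.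

Lemma integrable_itv_bounded (f : R -> R) c eps : measurable_fun [set: R] f ->
  (forall x, `|f x| <= 1) ->
  mu.-integrable `[c, c + eps]%classic (EFin \o f).
Proof.
move=> mf f1; apply: measurable_bounded_integrable.
- exact: mitv.
- by rewrite /= lebesgue_measure_itv/=; case: ifP => // _; exact: ltry.
- exact: measurable_funTS.
- exists 1; split=> [|M M1 x _ /=]; first exact: num_real.
  by rewrite (le_trans (f1 x))// ltW.
Qed.

Lemma integrable_Re_conjc_e c eps l : mu.-integrable `[c, c + eps]%classic
  (EFin \o (fun x => complex.Re (conjc (e l x)))).
Proof.
apply: integrable_itv_bounded; first by have [] := measurable_e_fst l.
by move=> x; rewrite Re_conjc Re_e_le1.
Qed.

Lemma integrable_Im_conjc_e c eps l : mu.-integrable `[c, c + eps]%classic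
  (EFin \o (fun x => complex.Im (conjc (e l x)))).
Proof.
apply: integrable_itv_bounded.
  by have [_ m] := measurable_e_fst l; apply: measurableT_comp => //.
by move=> x; rewrite Im_conjc normrN Im_e_le1.
Qed.

Lemma itv_transform_shift c eps s l :
  itv_transform (c + s) eps l = conjc (e l s) * itv_transform c eps l.
Proof.
have shift (f : R -> R) : measurable_fun [set: R] f -> (forall x, `|f x| <= 1) ->
    \int[mu]_(x in `[c + s, c + s + eps]%classic) f x =
    \int[mu]_(x in `[c, c + eps]%classic) f (x + s).
  move=> mf f1; rewrite [LHS]Rintegral_indic_mul [RHS]Rintegral_indic_mul.
  rewrite -(@Rintegral_shift _ s (fun x => \1_(`[c + s, c + s + eps]%classic : set R) x * f x)).
    apply: eq_Rintegral => x _; congr (_ * _); rewrite !indicE; congr ((nat_of_bool _)%:R).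
    by apply/idP/idP => /set_mem/=; rewrite in_itv/= => h; apply/mem_set; rewrite /= in_itv/=; lra.
  apply: integrable_indic_mul; first exact: measurable_itv.
  exact: integrable_itv_bounded.
have [me1 me2] := measurable_e_fst l.
apply/eqP; rewrite eq_complex; apply/andP; split; apply/eqP.
  rewrite (@Re_mul_cintegral _ (measurableTypeR R) R mu _ (mitv c eps) (conjc (e l s)) (fun x => conjc (e l x))).
  - rewrite [LHS]shift//; last by move=> x; rewrite Re_conjc Re_e_le1.
    by apply: eq_Rintegral => x _; rewrite e_addr rmorphM mulrC.
  - exact: integrable_Re_conjc_e.
  - exact: integrable_Im_conjc_e.
(* Im z = Re(-i z) reduces the imaginary part to the case of real parts. *)
have ImRe (z : R[i]) : complex.Im z = complex.Re (Complex 0 (-1) * z).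
  by case: z => ? ? /=; ring.
rewrite [RHS]ImRe mulrA.
rewrite (@Re_mul_cintegral _ (measurableTypeR R) R mu _ (mitv c eps) _ (fun x => conjc (e l x))).
- rewrite [LHS]shift//.
  + apply: eq_Rintegral => x _; rewrite ImRe -!mulrA; congr (complex.Re (_ * _)).
    by rewrite e_addr rmorphM mulrC.
  + by apply: measurableT_comp => //.
  + by move=> x; rewrite Im_conjc normrN Im_e_le1.
- exact: integrable_Re_conjc_e.
- exact: integrable_Im_conjc_e.
Qed.

Lemma cos_ge_cos1 x : `|x| <= 1 -> cos 1 <= cos x.
Proof.
move=> x1; rewrite -(cos_norm x); have pi2 : 2 <= pi :> R := pi_ge2 R.
have [->//|n1] := eqVneq `|x| 1.
rewrite ltW// ltr_cos ?in_itv/=; [|have := normr_ge0 x; lra|lra].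
by rewrite lt_neqAle n1.
Qed.

(** Rotating by e_l(c) keeps the modulus and turns the real part of the integrand into cos(2 pi l (x
    - c)). The phase stays within [-1, 1] on the interval, so this cosine is at least cos 1. *)
Lemma itv_transform_ge c eps l : 0 < eps -> `|2 * pi * l| * eps <= 1 ->
  (eps * cos 1) ^+ 2 <= normc (itv_transform c eps l) ^+ 2.
Proof.
move=> eps0 small.
have -> : normc (itv_transform c eps l) ^+ 2 = normc (e l c * itv_transform c eps l) ^+ 2.
  rewrite /e; case: (itv_transform c eps l) => u v; rewrite !normc_sqr /=.
  have := cos2Dsin2 (2 * pi * l * c); set p := cos _; set q := sin _ => pq.
  by rewrite -[LHS]mul1r -pq; ring.
rewrite normc_sqr.
have Re_ec x : complex.Re (e l c * conjc (e l x)) = cos (2 * pi * l * (x - c)).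
  by rewrite /e /= mulrBr cosB; ring.
have : eps * cos 1 <= complex.Re (e l c * itv_transform c eps l).
  rewrite (@Re_mul_cintegral _ (measurableTypeR R) R mu _ (mitv c eps) _ (fun x => conjc (e l x))).
  - have -> : eps * cos 1 = \int[mu]_(x in `[c, c + eps]%classic) (cos 1 : R).
      rewrite Rintegral_cst; last exact: mitv.
      by rewrite /= lebesgue_measure_itv/= lte_fin ltrDl eps0/= addrC addKr mulrC.
    apply: le_Rintegral.
    + exact: mitv.
    + apply: integrable_itv_bounded; first exact: measurable_cst.
      by move=> x; exact: cos_max.
    + have mm : measurable_fun [set: R] (fun x => complex.Re (e l c * conjc (e l x))).
        have [me1 me2] := measurable_e_fst l.
        rewrite (_ : (fun x => _) = fun x => complex.Re (e l c) * complex.Re (e l x) +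
          complex.Im (e l c) * complex.Im (e l x)).
          by apply: measurable_funD; apply: measurable_funM.
        by apply/funext => x; rewrite /e /=; ring.
      by apply: integrable_itv_bounded => // x; have := cos_max (2 * pi * l * (x - c)); rewrite -Re_ec.
    + move=> x xI; rewrite Re_ec; move: xI; rewrite /= in_itv/= => /andP[cx xc].
      apply: cos_ge_cos1; rewrite normrM (le_trans _ small)// ler_wpM2l//.
      by rewrite ger0_norm; lra.
  - exact: integrable_Re_conjc_e.
  - exact: integrable_Im_conjc_e.
have k0 : 0 <= eps * cos 1 by rewrite mulr_ge0 ?ltW// cos1_gt0.
move=> h; have h2 : (eps * cos 1) ^+ 2 <= complex.Re (e l c * itv_transform c eps l) ^+ 2.
  by rewrite lerXn2r ?nnegrE// (le_trans k0).
by rewrite (le_trans h2)// lerDl sqr_ge0.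
Qed.

End Exponentials.

(** * Almost everywhere nonvanishing of a translation-invariant weight *)

Lemma ae_imp d (T : measurableType d) (R : realType) (m : {measure set T -> \bar R})
    (P Q : T -> Prop) : (forall x, P x -> Q x) ->
  {ae m, forall x, P x} -> {ae m, forall x, Q x}.
Proof. by move=> PQ; apply: filterS. Qed.

Lemma ae_imp2 d (T : measurableType d) (R : realType) (m : {measure set T -> \bar R})
    (P Q S : T -> Prop) : (forall x, P x -> Q x -> S x) ->
  {ae m, forall x, P x} -> {ae m, forall x, Q x} -> {ae m, forall x, S x}.
Proof. by move=> PQS; apply: filterS2. Qed.

(* In the application w = |A_0|^2 F, [beta0] bounds a half-line contained in J_0, and
   rho c eps s is the length of the overlap of [c, c + eps] with its translate by s. *)
Section WeightNonvanishing.
Context (R : realType) (beta0 : R) (w : R -> R) (rho : R -> R -> R -> R).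
Local Notation mu := (@lebesgue_measure R).
Local Notation itv_power c eps l := (normc (itv_transform c eps l) ^+ 2).
Hypothesis mw : measurable_fun [set: R] w.
Hypothesis w0 : forall l, 0 <= w l.
Hypothesis rho0 : forall c eps, 0 < eps -> 0 < rho c eps 0.
Hypothesis w_integrable : forall c eps xi, 0 < eps -> c + eps < beta0 ->
  mu.-integrable setT (EFin \o (fun l => w l * itv_power c eps (l - xi))).
Hypothesis w_cos : forall c eps xi s, 0 < eps -> c + eps < beta0 -> s <= 0 ->
  \int[mu]_l (w l * itv_power c eps (l - xi) * cos (2 * pi * (l - xi) * s)) = rho c eps s.
Hypothesis w_sin : forall c eps xi s, 0 < eps -> c + eps < beta0 -> s <= 0 ->
  \int[mu]_l (w l * itv_power c eps (l - xi) * sin (2 * pi * (l - xi) * s)) = 0.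

(** The two sides have the same cosine and sine transforms, because the right-hand sides of [w_cos]
    and [w_sin] are free of xi; injectivity of the Fourier transform concludes. *)
Lemma weight_shift_ae c eps xi : 0 < eps -> c + eps < beta0 ->
  {ae mu, forall l, w (l + xi) * itv_power c eps l = w l * itv_power c eps l}.
Proof.
move=> eps0 ceps.
(* The integrand of the hypotheses at frequency [z], after the substitution l -> l + z. *)
pose h z l := w (l + z) * itv_power c eps l.
have ih z : mu.-integrable setT (EFin \o h z).
  have := integrable_shift z (w_integrable z eps0 ceps).
  by apply: eq_integrable => // l _ /=; rewrite addrK.
have pi0 : 2 * pi != 0 :> R by rewrite mulf_neq0// gt_eqF// pi_gt0.
have hcos z s : s <= 0 -> \int[mu]_l (h z l * cos (2 * pi * s * l)) = rho c eps s.
  move=> s0; rewrite -(w_cos z eps0 ceps s0).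
  rewrite -(@Rintegral_shift _ z (fun l => w l * itv_power c eps (l - z) * cos (2 * pi * (l - z) * s))).
    by apply: eq_Rintegral => l _; rewrite /h addrK; congr (_ * cos _); ring.
  have := integrable_shift (- z) (integrable_mul_cos (2 * pi * s) (ih z)).
  by apply: eq_integrable => // l _ /=; rewrite /h subrK; congr (_ * cos _)%:E; ring.
have hsin z s : s <= 0 -> \int[mu]_l (h z l * sin (2 * pi * s * l)) = 0.
  move=> s0; rewrite -[RHS](w_sin z eps0 ceps s0).
  rewrite -(@Rintegral_shift _ z (fun l => w l * itv_power c eps (l - z) * sin (2 * pi * (l - z) * s))).
    by apply: eq_Rintegral => l _; rewrite /h addrK; congr (_ * sin _); ring.
  have := integrable_shift (- z) (integrable_mul_sin (2 * pi * s) (ih z)).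
  by apply: eq_integrable => // l _ /=; rewrite /h subrK; congr (_ * sin _)%:E; ring.
have vd : vanishing_transform (fun l => h xi l - h 0 l).
  split=> [|t]; first exact: integrableB_EFin.
  (* The hypotheses cover s <= 0 only; parity of cos and sin reduces any frequency t to -|t|, at the
     cost of the sign -sg t for the sine. *)
  pose s := - (`|t| / (2 * pi)).
  have s0 : s <= 0 by rewrite oppr_le0 divr_ge0// mulr_ge0// ltW// pi_gt0.
  have tE l : cos (t * l) = cos (2 * pi * s * l).
    have -> : 2 * pi * s = - `|t| by rewrite /s mulrN mulrC divfK.
    by have [t0|t0] := leP 0 t; rewrite ?(ger0_norm t0) ?(ltr0_norm t0) ?opprK// mulNr cosN.
  have tE' l : exists2 k : R, sin (t * l) = k * sin (2 * pi * s * l) & k = - Num.sg t.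
    exists (- Num.sg t) => //.
    have -> : 2 * pi * s = - `|t| by rewrite /s mulrN mulrC divfK.
    have [t0|t0|->] := ltgtP t 0.
    - by rewrite ltr0_sg// ltr0_norm// !opprK mul1r.
    - by rewrite gtr0_sg// gtr0_norm// mulN1r mulNr sinN opprK.
    - by rewrite normr0 oppr0 !mul0r sin0 mulr0.
  split.
    under eq_Rintegral do rewrite tE mulrBl.
    by rewrite RintegralB ?hcos ?subrr//; exact: integrable_mul_cos.
  rewrite (_ : (fun l => _) = fun l => (h xi l * sin (2 * pi * s * l) - h 0 l * sin (2 * pi * s * l)) * (- Num.sg t)).
    rewrite RintegralZr//.
      by rewrite RintegralB ?hsin ?subrr ?mul0r//; exact: integrable_mul_sin.
    by apply: integrableB_EFin => //; exact: integrable_mul_sin.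
  by apply/funext => l; have [k -> ->] := tE' l; ring.
have := (vanishing_transform_ae0 vd); apply: ae_imp => l /eqP.
by rewrite /h addr0 subr_eq0 => /eqP.
Qed.

(** Let S be a bounded part of the zero set of w. Wherever the interval transform is nonzero,
    invariance gives w(l + xi) = 0 for every xi and almost every l in S. Tonelli turns this into |S|
    times the integral of w being 0, and that integral is not 0. *)
Lemma weight_ae_neq0 : {ae mu, forall l, w l != 0}.
Proof.
have wE : measurable_fun [set: R] (EFin \o w) by exact/measurable_EFinP.
(* [C] may be infinite; the product of |S| and [C] is zero only if a factor is, in the extended
   reals too. *)
pose C := (\int[mu]_l (w l)%:E)%E.
have C0 : C != 0%E.
  apply/eqP => C0.
  have wae : {ae mu, forall l, w l = 0}.
    have := ae_eq_integral_abs mu measurableT wE.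
    rewrite (_ : (\int[mu]_x _)%E = C); last first.
      by apply: eq_integral => l _ /=; rewrite ger0_norm.
    move=> [/(_ C0) + _]; by apply: ae_imp => l /(_ I) [].
  (* The interval [beta0 - 2, beta0 - 1] is admissible, and a null weight would contradict its
     positive overlap with itself. *)
  have : rho (beta0 - 2) 1 0 = 0.
    rewrite -(w_cos 0 ltr01 _ (lexx 0)); last by lra.
    under eq_Rintegral do rewrite mulr0 cos0 mulr1.
    rewrite -[RHS](mul0r (fine (mu setT))) -(Rintegral_cst mu measurableT 0).
    congr fine; apply: ae_eq_integral => //.
      by have := measurable_int _ (@w_integrable (beta0 - 2) 1 0 ltr01 ltac:(lra)).
    by have := wae; apply: ae_imp => l -> _; rewrite !mul0r.
  by move=> h; have := rho0 (beta0 - 2) ltr01; rewrite h ltxx.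
have SN N : mu [set l | w l = 0 /\ `|l| <= N%:R] = 0%E.
  set S := [set l | _].
  (* Short enough for [itv_transform_ge] when |l| <= N; N + 1 replaces N to allow N = 0. *)
  pose eps : R := (2 * pi * N.+1%:R)^-1.
  have eps0 : 0 < eps by rewrite invr_gt0 !mulr_gt0// pi_gt0.
  have ceps : beta0 - 2 * eps + eps < beta0 by lra.
  have mS : @measurable _ (measurableTypeR R) S.
    rewrite (_ : S = w @^-1` [set 0] `&` `[- N%:R, N%:R]%classic).
      apply: measurableI; last exact: measurable_itv.
      by rewrite -[X in measurable X]setTI; exact: mw.
    by apply/seteqP; split => l; rewrite /S /= in_itv/= -ler_norml.
  have wS xi : {ae mu, forall l, \1_S l * w (l + xi) = 0}.
    have := (weight_shift_ae xi eps0 ceps); apply: ae_imp => l.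
    rewrite indicE; case: (boolP (l \in S)) => [/set_mem[wl lN]|_ _]; last by rewrite mul0r.
    rewrite wl mul0r mul1r => /eqP; rewrite mulf_eq0 => /orP[/eqP//|/eqP H0].
    have : (eps * cos 1) ^+ 2 <= 0 :> R.
      rewrite -H0; apply: itv_transform_ge => //.
      rewrite /eps normrM (@gtr0_norm _ (2 * pi)) ?mulr_gt0 ?pi_gt0//.
      rewrite ler_pdivrMr ?mul1r; last by rewrite !mulr_gt0// pi_gt0.
      rewrite ler_pM2l ?mulr_gt0 ?pi_gt0// (le_trans lN)// ler_nat.
      exact: leqnSn.
    by rewrite leNgt exprn_gt0// mulr_gt0// cos1_gt0.
  pose Phi (p : R * R) := (\1_S p.1 * w (p.1 + p.2))%:E.
  have mPhi : measurable_fun setT Phi.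
    apply/measurable_EFinP; apply: measurable_funM.
      by apply: measurableT_comp => //; apply: measurable_indic.
    by apply: measurableT_comp => //; exact: measurable_funD.
  have Phi0 p : (0 <= Phi p)%E by rewrite lee_fin mulr_ge0.
  have := @fubini_tonelli _ _ _ _ _ mu mu Phi mPhi Phi0.
  have -> : (\int[mu]_y \int[mu]_x Phi (x, y) = 0)%E.
    apply: integral0_eq => y _.
    rewrite (ae_eq_integral (cst 0%E)) ?integral0//.
      by have := measurableT_comp mPhi (pair2_measurable y).
    by have := (wS y); apply: ae_imp => l H _; rewrite /Phi /= H.
  have -> : (\int[mu]_x \int[mu]_y Phi (x, y) = \int[mu]_x ((\1_S x)%:E * C))%E.
    apply: eq_integral => x _.
    rewrite /C -(ge0_integral_shift x wE); last by move=> l; rewrite lee_fin.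
    rewrite -ge0_integralZl//.
    - by apply: eq_integral => y _; rewrite /Phi /= EFinM addrC.
    - by apply/measurable_EFinP; apply: measurableT_comp => //; exact: measurable_funD.
    - by move=> l _; rewrite lee_fin.
  rewrite ge0_integralZr//; last 2 first.
  - by apply/measurable_EFinP; exact: measurable_indic.
  - by apply: integral_ge0 => l _; rewrite lee_fin.
  rewrite integral_indic// setIT => /eqP; rewrite mule_eq0 (negbTE C0) orbF.
  by move/eqP.
have : mu.-negligible (\bigcup_N [set l | w l = 0 /\ `|l| <= N%:R]).
  apply: negligible_bigcup => N; apply/negligibleP; last exact: SN.
  rewrite (_ : [set l | _] = w @^-1` [set 0] `&` `[- N%:R, N%:R]%classic).
    apply: measurableI; last exact: measurable_itv.
    by rewrite -[X in measurable X]setTI; exact: mw.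
  by apply/seteqP; split => l; rewrite /= in_itv/= -ler_norml.
apply: negligibleS => l /= /negP; rewrite negbK => /eqP wl.
by exists (Num.bound `|l|) => //; split => //; rewrite ltW// archi_boundP.
Qed.

End WeightNonvanishing.
(** * Generalized eigenfunctions on the components of Omega *)

Section Geometry.
Context (R : realType) (n : nat) (alpha beta : 'I_n -> R).
Hypothesis ab : interlaced alpha beta.

Lemma alpha_lt_beta (i j : 'I_n) : (i < j)%N -> alpha i < beta j.
Proof.
case: ab => ba ab1.
move: {2}(j : nat) (leqnn j) => m; elim: m j => [|m ih] j jm ij.
  by move: jm; rewrite leqn0 => /eqP j0; rewrite j0 in ij.
have [eij|nij] := eqVneq (j : nat) i.+1; first exact: ab1.
have j1 : (j.-1 < n)%N by rewrite (leq_ltn_trans (leq_pred j)).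
pose j' := Ordinal j1.
have jE : j = j'.+1 :> nat by rewrite /= prednK// (leq_trans _ ij).
apply: (lt_trans _ (ab1 _ _ jE)); apply: (lt_trans _ (ba j')); apply: ih => /=.
  by rewrite -ltnS -(ltn_predK ij) in jm *.
by rewrite -ltnS -jE ltn_neqAle eq_sym nij.
Qed.

(** The component just right of alpha_i has index [lift ord0 i], the one just left of beta_i has
    index [lift ord_max i]. An infinite endpoint becomes a vacuous condition, so no case on k is
    left to the users. *)
Lemma J_P (k : 'I_n.+1) x : J alpha beta k x <->
  (forall i, lift ord0 i = k -> alpha i < x) /\
  (forall i, lift ord_max i = k -> x < beta i).
Proof.
rewrite /J /= in_itv /=; case: unliftP => [i ->|->]; case: unliftP => [j jE|jE] /=.
- split=> [/andP[h1 h2]|[h1 h2]]; last by rewrite h1//= h2.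
  split=> m mE; first by move/lift_inj: mE => ->.
  by have -> : m = j by apply: (@lift_inj _ ord_max); rewrite -jE.
- split=> [/andP[h1 _]|[h1 _]]; last by rewrite h1.
  split=> m mE; first by move/lift_inj: mE => ->.
  by move: mE; rewrite jE => /eqP; rewrite eq_sym (negbTE (neq_lift _ _)).
- split=> [h|[_ h]]; last by rewrite h.
  split=> m mE; first by move: mE => /eqP; rewrite eq_sym (negbTE (neq_lift _ _)).
  by have -> : m = j by apply: (@lift_inj _ ord_max); rewrite -jE.
- split=> // _; split=> m mE; first by move: mE => /eqP; rewrite eq_sym (negbTE (neq_lift _ _)).
  by move: mE; rewrite jE => /eqP; rewrite eq_sym (negbTE (neq_lift _ _)).
Qed.

Lemma J_disjoint k l x : J alpha beta k x -> J alpha beta l x -> k = l.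
Proof.
wlog kl : k l / (k < l)%N => [H Jk Jl|].
  have [kl|lk|/val_inj//] := ltngtP k l; first exact: H.
  by apply/esym; exact: H.
move=> /J_P[_ Jk] /J_P[Jl _]; exfalso.
have kn : (k < n)%N by rewrite (leq_trans kl)// -ltnS.
have ln : (l.-1 < n)%N by rewrite -ltnS (ltn_predK kl).
(* Component k ends at beta with index k, component l starts at alpha with index l - 1 >= k, and
   beta with index k lies below that alpha. *)
have := Jk (Ordinal kn); have := Jl (Ordinal ln).
have -> : lift ord0 (Ordinal ln) = l by apply: val_inj; rewrite /= /bump /= add1n (ltn_predK kl).
have -> : lift ord_max (Ordinal kn) = k by apply: val_inj; rewrite /= /bump /= leqNgt kn.
move=> /(_ erefl) al /(_ erefl) bk.
have : beta (Ordinal kn) < alpha (Ordinal ln).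
  have [e|ne] := eqVneq (l.-1) k.
    have -> : Ordinal ln = Ordinal kn by apply: val_inj.
    exact: ab.1.
  apply: (lt_trans (ab.1 _)); apply: lt_trans (ab.1 _).
  apply: alpha_lt_beta => /=.
  by rewrite ltn_neqAle eq_sym ne /= -ltnS (ltn_predK kl).
by move=> h; have := lt_trans (lt_trans bk h) al; rewrite ltxx.
Qed.

Lemma J_right k x : J alpha beta k x ->
  exists2 d, 0 < d & forall y, x <= y <= x + d -> J alpha beta k y.
Proof.
move=> /J_P[Jl Jr].
have [[i ik]|nk] := pselect (exists i, lift ord_max i = k).
  exists ((beta i - x) / 2); first by rewrite divr_gt0// subr_gt0 Jr.
  move=> y /andP[xy yx]; apply/J_P; split=> [m mk|m mk].
    by rewrite (lt_le_trans (Jl _ mk)).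
  have -> : m = i by apply: (@lift_inj _ ord_max); rewrite mk.
  have := Jr _ ik; lra.
exists 1 => // y /andP[xy yx]; apply/J_P; split=> [m mk|m mk].
  by rewrite (lt_le_trans (Jl _ mk)).
by exfalso; apply: nk; exists m.
Qed.

Lemma J_nonempty k : exists x, J alpha beta k x.
Proof.
have [[i ik]|nk] := pselect (exists i, lift ord_max i = k).
  have [[j jk]|nj] := pselect (exists j, lift ord0 j = k).
    have ji : alpha j < beta i.
      apply: alpha_lt_beta; have : lift ord0 j = lift ord_max i :> nat by rewrite ik jk.
      by rewrite /= /bump /= add1n [(n <= i)%N]leqNgt ltn_ord add0n => <-.
    exists ((alpha j + beta i) / 2); apply/J_P; split=> m mk.
      have -> : m = j by apply: (@lift_inj _ ord0); rewrite mk.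
      lra.
    have -> : m = i by apply: (@lift_inj _ ord_max); rewrite mk.
    lra.
  exists (beta i - 1); apply/J_P; split=> m mk; first by exfalso; apply: nj; exists m.
  have -> : m = i by apply: (@lift_inj _ ord_max); rewrite mk.
  lra.
have [[j jk]|nj] := pselect (exists j, lift ord0 j = k).
  exists (alpha j + 1); apply/J_P; split=> m mk; last by exfalso; apply: nk; exists m.
  have -> : m = j by apply: (@lift_inj _ ord0); rewrite mk.
  lra.
exists 0; apply/J_P; split=> m mk; exfalso; first by apply: nj; exists m.
by apply: nk; exists m.
Qed.

Lemma measurable_J k : measurable (J alpha beta k).
Proof. exact: measurable_itv. Qed.

Lemma measurable_Omega : measurable (Omega alpha beta).
Proof.
by apply: fin_bigcup_measurable => [|k _]; [exact: finite_finset|exact: measurable_J].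
Qed.

(** This half-line is where the test intervals are translated freely to the left. *)
Lemma J_left : exists b, forall x, x < b -> J alpha beta ord0 x.
Proof.
have [[i ik]|nk] := pselect (exists i, lift ord_max i = (ord0 : 'I_n.+1)).
  exists (beta i) => x xb; apply/J_P; split=> m mk; first by move: mk => /eqP; rewrite eq_sym (negbTE (neq_lift _ _)).
  by have -> : m = i by apply: (@lift_inj _ ord_max); rewrite mk.
exists 0 => x _; apply/J_P; split=> m mk; first by move: mk => /eqP; rewrite eq_sym (negbTE (neq_lift _ _)).
by exfalso; apply: nk; exists m.
Qed.

End Geometry.

Section ComplexMeasurable.
Context d (T : measurableType d) (R : realType) (D : set T).
Implicit Types f g : T -> R[i].

Lemma cmeasurableM f g : cmeasurable D f -> cmeasurable D g ->
  cmeasurable D (fun x => f x * g x).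
Proof.
move=> [f1 f2] [g1 g2]; split.
  rewrite (_ : (fun x => _) = fun x => complex.Re (f x) * complex.Re (g x) -
      complex.Im (f x) * complex.Im (g x)).
    by apply: measurable_funB; exact: measurable_funM.
  by apply/funext => x; case: (f x) (g x) => ? ? [? ?].
rewrite (_ : (fun x => _) = fun x => complex.Re (f x) * complex.Im (g x) +
    complex.Im (f x) * complex.Re (g x)).
  by apply: measurable_funD; exact: measurable_funM.
by apply/funext => x; case: (f x) (g x) => ? ? [? ?].
Qed.

Lemma cmeasurable_conj f : cmeasurable D f -> cmeasurable D (fun x => conjc (f x)).
Proof.
move=> [f1 f2]; split; first by under eq_fun do rewrite Re_conjc.
by under eq_fun do rewrite Im_conjc; exact: measurableT_comp.
Qed.

End ComplexMeasurable.

(** The definition provides coefficients for each lambda separately, without regularity in lambda.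
    Evaluating psi_lambda at a fixed point of J_k and removing the phase recovers A_k(lambda) as a
    measurable function. *)
Lemma eigenfunction_coefficients (R : realType) (n : nat) (alpha beta : 'I_n -> R)
    (B : 'M[R[i]]_n) (psi : R -> R -> R[i]) :
  interlaced alpha beta -> bounded_eigenfunction_system alpha beta B psi ->
  exists a : 'I_n.+1 -> R -> R[i],
    (forall k, cmeasurable setT (a k)) /\
    (forall k l x, J alpha beta k x -> psi l x = a k l * e l x).
Proof.
move=> ab [eig _ mpsi].
have [xk Jxk] := choice (J_nonempty ab).
have Oxk k : Omega alpha beta (xk k) by exists k.
exists (fun k l => psi l (xk k) * conjc (e l (xk k))); split=> [k|k l x Jx].
  apply: cmeasurableM; first exact: mpsi.
  by apply: cmeasurable_conj; exact: measurable_e_snd.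
have [[A psiE] _] := eig l.
have sumE y : J alpha beta k y -> \sum_j A j * \1_(J alpha beta j) y = A k.
  move=> Jy; rewrite (bigD1 k)//= indicE mem_set// mulr1 big1 ?addr0// => j jk.
  rewrite indicE memNset ?mulr0// => Jj; move/eqP: jk; apply.
  exact: (J_disjoint ab Jj Jy).
rewrite !psiE//; last by exists k.
rewrite !sumE//; first by rewrite -[_ * conjc _]mulrA e_conjcK mulr1.
Qed.
Section ComplexIntegralLinear.
Context d (T : measurableType d) (R : realType).
Variables (m : {measure set T -> \bar R}) (D : set T).
Hypothesis mD : measurable D.

Lemma cintegralZl (z : R[i]) (h : T -> R[i]) :
  m.-integrable D (EFin \o (fun x => complex.Re (h x))) ->
  m.-integrable D (EFin \o (fun x => complex.Im (h x))) ->
  cintegral m D (fun x => z * h x) = z * cintegral m D h.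
Proof.
move=> h1 h2; apply/eqP; rewrite eq_complex; apply/andP; split; apply/eqP.
  by rewrite Re_mul_cintegral.
have ImRe (v : R[i]) : complex.Im v = complex.Re (Complex 0 (-1) * v).
  by case: v => ? ? /=; ring.
rewrite [RHS]ImRe mulrA Re_mul_cintegral//.
by apply: eq_Rintegral => x _; rewrite ImRe mulrA.
Qed.

Lemma eq_cintegral (f g : T -> R[i]) : {in D, f =1 g} ->
  cintegral m D f = cintegral m D g.
Proof. by move=> fg; congr Complex; apply: eq_Rintegral => x Dx; rewrite fg. Qed.

Lemma cintegral_indic (E : set T) (h : T -> R[i]) : E `<=` D ->
  cintegral m D (fun x => (\1_E x)%:C%C * h x) = cintegral m E h.
Proof.
move=> ED.
have key (f : T -> R) : \int[m]_(x in D) (\1_E x * f x) = \int[m]_(x in E) f x.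
  rewrite -{2}(setIidr ED) Rintegral_mkcondr; apply: eq_Rintegral => x _.
  by rewrite patchE indicE; case: (_ \in _); rewrite ?mul1r ?mul0r.
congr Complex; rewrite -key; apply: eq_Rintegral => x _.
  by case: (h x) => u v /=; ring.
by case: (h x) => u v /=; ring.
Qed.

Lemma inL2_ae (f g : T -> R[i]) : cmeasurable D g -> inL2 m D f ->
  ae_eq m D f g -> inL2 m D g.
Proof.
move=> mg [mf fi] fg; split => //.
move: fi; rewrite /sqnormL2 (ae_eq_integral (fun x => (normc (g x) ^+ 2)%:E))//.
- apply/measurable_EFinP; under eq_fun do rewrite normc_sqr.
  by have [? ?] := mf; apply: measurable_funD; exact: measurable_funX.
- apply/measurable_EFinP; under eq_fun do rewrite normc_sqr.
  by have [? ?] := mg; apply: measurable_funD; exact: measurable_funX.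
- by apply: filterS fg => x /= H Dx; rewrite H.
Qed.

Lemma rip_eq0_ae (f g : T -> R[i]) : inL2 m D f -> inL2 m D g ->
  rip m D (fun x => f x - g x) (fun x => f x - g x) = 0 -> ae_eq m D f g.
Proof.
move=> fL gL /rip_eq0 h; have := h mD (inL2B mD fL gL).
by apply: filterS => x /= H Dx; apply/eqP; rewrite -subr_eq0 H.
Qed.

End ComplexIntegralLinear.

(** * The kernel psi as a phase on each component, and its action on test waves *)

Section PhaseKernel.
Context (R : realType) (n : nat) (alpha beta : 'I_n -> R).
Hypothesis ab : interlaced alpha beta.
Local Notation mu := (@lebesgue_measure R).
Local Notation Omega := (Omega alpha beta).
Local Notation J := (J alpha beta).
Local Notation window N := (`[- (N%:R : R), N%:R]%classic : set R).
Variables (psi : R -> R -> R[i]) (a : 'I_n.+1 -> R -> R[i]).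
Hypothesis ma : forall k, cmeasurable setT (a k).
Hypothesis psiE : forall k l x, J k x -> psi l x = a k l * e l x.

Definition coefficient_bound (l : R) : R :=
  \sum_k (`|complex.Re (a k l)| + `|complex.Im (a k l)|).

Lemma coefficient_bound_ge0 l : 0 <= coefficient_bound l.
Proof. by apply: sumr_ge0 => k _; rewrite addr_ge0. Qed.

Lemma psi_Re_le l x : Omega x -> `|complex.Re (psi l x)| <= coefficient_bound l.
Proof.
move=> [k _ Jx]; rewrite (psiE l Jx) /coefficient_bound (bigD1 k)//=.
apply: (@le_trans _ _ (`|complex.Re (a k l)| + `|complex.Im (a k l)|)); last first.
  by rewrite lerDl sumr_ge0// => j _; rewrite addr_ge0.
case: (a k l) => u v /=; rewrite (le_trans (ler_normB _ _))// !normrM.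
by apply: lerD; rewrite ler_piMr// ?cos_max ?sin_max.
Qed.

Lemma psi_Im_le l x : Omega x -> `|complex.Im (psi l x)| <= coefficient_bound l.
Proof.
move=> [k _ Jx]; rewrite (psiE l Jx) /coefficient_bound (bigD1 k)//=.
apply: (@le_trans _ _ (`|complex.Re (a k l)| + `|complex.Im (a k l)|)); last first.
  by rewrite lerDl sumr_ge0// => j _; rewrite addr_ge0.
case: (a k l) => u v /=; rewrite (le_trans (ler_normD _ _))// !normrM.
by apply: lerD; rewrite ler_piMr// ?cos_max ?sin_max.
Qed.

Lemma cmeasurable_phase k : cmeasurable setT (fun p : R * R => a k p.2 * e p.2 p.1).
Proof.
apply: cmeasurableM; last exact: measurable_e_pair.
have [m1 m2] := ma k.
by split; [exact: (measurable_snd_comp m1)|exact: (measurable_snd_comp m2)].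
Qed.

(** Disjointness of the components leaves at most one term; joint measurability of psi is thus read
    off from the phases. *)
Lemma indic_Omega_sum (f : R -> R) (g : 'I_n.+1 -> R -> R) x :
  (forall k, J k x -> f x = g k x) ->
  \1_Omega x * f x = \sum_k \1_(J k) x * g k x.
Proof.
move=> fg; have [[k _ Jx]|nO] := pselect (Omega x).
  rewrite (bigD1 k)//= big1 ?addr0 => [|j jk].
    by rewrite !indicE !mem_set ?(fg k)//; exists k.
  rewrite indicE memNset ?mul0r// => Jj; move/eqP: jk; apply.
  exact: (J_disjoint ab Jj Jx).
rewrite indicE memNset// mul0r big1// => k _; rewrite indicE memNset ?mul0r// => Jx.
by apply: nO; exists k.
Qed.

Lemma measurable_psi_Re :
  measurable_fun setT (fun p : R * R => \1_Omega p.1 * complex.Re (psi p.2 p.1)).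
Proof.
rewrite (_ : (fun p => _) = fun p : R * R => \sum_k \1_(J k) p.1 * complex.Re (a k p.2 * e p.2 p.1)).
  apply: measurable_sum => k; apply: measurable_funM; last by have [] := cmeasurable_phase k.
  apply: (@measurable_fst_comp _ (\1_(J k))); apply: measurable_indic; exact: measurable_J.
apply/funext => p.
by apply: (@indic_Omega_sum (fun x => complex.Re (psi p.2 x)) (fun k x => complex.Re (a k p.2 * e p.2 x))) => k Jx; rewrite (psiE _ Jx).
Qed.

Lemma measurable_psi_Im :
  measurable_fun setT (fun p : R * R => \1_Omega p.1 * complex.Im (psi p.2 p.1)).
Proof.
rewrite (_ : (fun p => _) = fun p : R * R => \sum_k \1_(J k) p.1 * complex.Im (a k p.2 * e p.2 p.1)).
  apply: measurable_sum => k; apply: measurable_funM; last by have [] := cmeasurable_phase k.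
  apply: (@measurable_fst_comp _ (\1_(J k))); apply: measurable_indic; exact: measurable_J.
apply/funext => p.
by apply: (@indic_Omega_sum (fun x => complex.Im (psi p.2 x)) (fun k x => complex.Im (a k p.2 * e p.2 x))) => k Jx; rewrite (psiE _ Jx).
Qed.

(** The test functions: an interval modulated to frequency xi. The amplitudes z = 1 and z = i
    recover complex identities from real parts of inner products. *)
Definition wave (z : R[i]) (c eps xi x : R) : R[i] :=
  (\1_(`[c, c + eps]%classic : set R) x)%:C%C * (z * e xi x).

Lemma wave_inL2 z c eps xi : inL2 mu Omega (wave z c eps xi).
Proof.
rewrite (_ : wave _ _ _ _ = fun x => z * e xi x * (\1_(`[c, c + eps]%classic : set R) x)%:C%C); last first.
  by apply/funext => x; rewrite /wave mulrC.
have mO := measurable_Omega alpha beta.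
have mE : measurable_fun [set: R] (\1_(`[c, c + eps]%classic : set R) : R -> R).
  by apply: measurable_indic; exact: measurable_itv.
have i1 : inL2 mu Omega (fun x => (\1_(`[c, c + eps]%classic : set R) x)%:C%C : R[i]).
  apply/inL2P => //; split => /=; split; rewrite ?expr0n//=.
  - exact: measurable_funTS.
  - have iE : mu.-integrable setT (EFin \o (\1_(`[c, c + eps]%classic : set R) : R -> R)).
      exact: integrable_indic_itv.
    have iO : mu.-integrable Omega (EFin \o (\1_(`[c, c + eps]%classic : set R) : R -> R)).
      by apply: (integrableS measurableT).
    apply: eq_integrable iO => // x _ /=.
    by rewrite indicE; case: (_ \in _); rewrite ?expr1n ?expr0n.
  - have i0 : mu.-integrable Omega (cst 0%E) by exact: integrable0.
    by apply: eq_integrable i0 => // x _ /=; rewrite ?expr0n ?mulr0.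
have [m1 m2] : cmeasurable setT (fun x : R => z * e xi x).
  by apply: cmeasurableM; [split; exact: measurable_cst|exact: measurable_e_fst].
apply: (@inL2_bounded_mul _ (measurableTypeR R) R mu Omega mO (fun x => z * e xi x)
  (`|complex.Re z| + `|complex.Im z|)) => //.
- by split; exact: measurable_funTS.
- move=> x _; case: z {m1 m2} => u v /=; rewrite (le_trans (ler_normB _ _))// !normrM.
  by apply: lerD; rewrite ler_piMr// ?cos_max ?sin_max.
- move=> x _; case: z {m1 m2} => u v /=; rewrite (le_trans (ler_normD _ _))// !normrM.
  by apply: lerD; rewrite ler_piMr// ?cos_max ?sin_max.
Qed.

Lemma truncated_transform_wave M k z c eps xi l :
  `[c, c + eps]%classic `<=` J k -> `[c, c + eps]%classic `<=` window M ->
  truncated_transform Omega psi M (wave z c eps xi) l =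
  conjc (a k l) * z * itv_transform c eps (l - xi).
Proof.
move=> EJ EM; rewrite /truncated_transform /innerL2.
have EO : `[c, c + eps]%classic `<=` Omega `&` window M.
  by move=> x Ex; split; [exists k => //; exact: EJ|exact: EM].
transitivity (cintegral mu (Omega `&` window M)
    (fun x => (\1_(`[c, c + eps]%classic : set R) x)%:C%C * (conjc (a k l) * z * conjc (e (l - xi) x)))).
  apply: eq_cintegral => x _; rewrite /wave.
  have [Ex|nEx] := pselect (`[c, c + eps]%classic x); last first.
    by rewrite indicE memNset//= !mul0r mulr0.
  rewrite (psiE l (EJ _ Ex)) rmorphM -conjc_e_mul; ring.
rewrite (@cintegral_indic _ (measurableTypeR R) R mu _ _ _ EO); apply: (@cintegralZl _ (measurableTypeR R)).
- exact: mitv.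
- exact: integrable_Re_conjc_e.
- exact: integrable_Im_conjc_e.
Qed.

End PhaseKernel.
(** * The spectral transform *)

Section SpectralTransform.
Context (R : realType) (n : nat) (alpha beta : 'I_n -> R).
Hypothesis ab : interlaced alpha beta.
Local Notation mu := (@lebesgue_measure R).
Local Notation Omega := (Omega alpha beta).
Local Notation J := (J alpha beta).
Local Notation window N := (`[- (N%:R : R), N%:R]%classic : set R).
Variables (psi : R -> R -> R[i]) (a : 'I_n.+1 -> R -> R[i]).
Hypothesis ma : forall k, cmeasurable setT (a k).
Hypothesis psiE : forall k l x, J k x -> psi l x = a k l * e l x.
Variables (F : R -> R) (F0 : forall x, 0 < F x) (mF : measurable_fun [set: R] F).
Local Notation sigma := (density_measure F0 mF).
Local Notation TM := (truncated_transform Omega psi).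
Local Notation plancherel := (plancherel_transform alpha beta psi F0 mF).

Let mO : @measurable _ (measurableTypeR R) Omega.
Proof. exact: measurable_Omega. Qed.

Let mT : @measurable _ (measurableTypeR R) setT.
Proof. exact: measurableT. Qed.

Let cmeasurable_TM M f : inL2 mu Omega f -> cmeasurable setT (TM M f).
Proof.
move=> [mf _]; apply: cmeasurable_truncated_transform => //.
- exact: (measurable_psi_Re ab ma psiE).
- exact: (measurable_psi_Im ab ma psiE).
Qed.

Lemma truncated_transform_stable M N f : (M <= N)%N ->
  (forall x, Omega x -> ~ window M x -> f x = 0) -> TM N f = TM M f.
Proof.
move=> MN f0; apply/funext => l; congr Complex;
  rewrite [LHS]Rintegral_mkcondr [RHS]Rintegral_mkcondr; apply: eq_Rintegral => x /set_mem Ox; rewrite !patchE;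
  (have [wM|nwM] := pselect (window M x); last first).
- rewrite [in X in _ = X]memNset//; case: ifP => // _.
  by rewrite (f0 _ Ox nwM) mulr0.
- rewrite !mem_set//; move: wM; rewrite /= !in_itv/= -!ler_norml => wM.
  by rewrite (le_trans wM)// ler_nat.
- rewrite [in X in _ = X]memNset//; case: ifP => // _.
  by rewrite (f0 _ Ox nwM) mulr0.
- rewrite !mem_set//; move: wM; rewrite /= !in_itv/= -!ler_norml => wM.
  by rewrite (le_trans wM)// ler_nat.
Qed.

(** The truncations of such an f are eventually constant, so their constant distance to the limit
    must be 0. *)
Lemma plancherel_compact_support M f g : inL2 mu Omega f ->
  (forall x, Omega x -> ~ window M x -> f x = 0) -> plancherel f g ->
  ae_eq sigma setT g (TM M f).
Proof.
move=> fL f0 [gL cv].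
pose s := sqnormL2 sigma setT (fun l => TM M f l - g l).
have s0 : s = 0%E.
  have c1 : sqnormL2 sigma setT (fun l => TM N f l - g l) @[N --> \oo] --> s.
    apply: cvg_near_cst; apply: filterS (nbhs_infty_ge M) => N MN.
    rewrite (truncated_transform_stable MN f0); reflexivity.
  exact: (cvg_unique (@ereal_hausdorff R) c1 cv).
have dL : inL2 sigma setT (fun l => TM M f l - g l).
  split; last by rewrite -/s s0 ltry.
  have [t1 t2] := cmeasurable_TM M fL; have [[g1 g2] _] := gL.
  by split; under eq_fun do rewrite raddfB; exact: measurable_funB.
move: s0; rewrite /s sqnormL2_rip// => -[] /(rip_eq0 mT dL).
by apply: filterS => l /= /(_ I) H _; apply/esym/eqP; rewrite -subr_eq0 H.
Qed.

Lemma plancherel_unique f g g' : inL2 mu Omega f -> plancherel f g ->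
  plancherel f g' -> ae_eq sigma setT g g'.
Proof.
move=> fL [gL cv] [gL' cv'].
have hL := inL2B mT gL gL'.
have c1 := cvgL2_rip mT (fun N => cmeasurable_TM N fL) gL hL cv.
have c2 := cvgL2_rip mT (fun N => cmeasurable_TM N fL) gL' hL cv'.
apply: (rip_eq0_ae mT gL gL').
by rewrite (ripBr mT hL gL gL') (cvg_unique (@norm_hausdorff _ _) c1 c2) ?subrr.
Qed.

Variable V : (R -> R[i]) -> (R -> R[i]).
Hypothesis VP : spectral_transform alpha beta psi F0 mF V.

Lemma wave_transform k (z : R[i]) (c eps xi : R) : `[c, c + eps]%classic `<=` J k ->
  ae_eq sigma setT (V (wave z c eps xi))
    (fun l => conjc (a k l) * z * itv_transform c eps (l - xi)).
Proof.
move=> EJ; pose M := Num.bound (`|c| + `|eps|).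
have EM : `[c, c + eps]%classic `<=` window M.
  move=> x /=; rewrite !in_itv/= -ler_norml => /andP[cx xc].
  have : `|c| + `|eps| <= M%:R by rewrite ltW// archi_boundP// addr_ge0.
  apply: le_trans; rewrite ler_norml.
  have := ler_norm c; have := ler_norm (- c); rewrite normrN.
  have := ler_norm eps; have := normr_ge0 eps; lra.
have wL := wave_inL2 alpha beta z c eps xi.
have := plancherel_compact_support (M := M) wL _ (VP wL).
have f0 x : Omega x -> ~ window M x -> wave z c eps xi x = 0.
  move=> _ nw; rewrite /wave indicE memNset ?mul0r// => /EM; exact: nw.
move=> /(_ f0); apply: filterS => l H lT; rewrite (H lT).
exact: (truncated_transform_wave psiE z xi l EJ EM).
Qed.

Lemma cmeasurable_itv_transform (c eps xi : R) :
  cmeasurable setT (fun l : R => itv_transform c eps (l - xi)).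
Proof.
have [m1 m2] := @measurable_e_pair R.
have mE : measurable_fun setT (\1_(`[c, c + eps]%classic : set R) : R -> R).
  by apply: measurable_indic; exact: measurable_itv.
have mEp := measurable_fst_comp mE.
have ms : measurable_fun [set: R] (fun l : R => l - xi) by exact: measurable_funB.
split.
  have : measurable_fun setT (fun l => \int[mu]_x (\1_(`[c, c + eps]%classic : set R) x * complex.Re (e l x))).
    apply: (@measurable_Rintegral_snd _ (fun p : R * R => \1_(`[c, c + eps]%classic : set R) p.1 * complex.Re (e p.2 p.1))).
    exact: measurable_funM.
  move=> /measurableT_comp /(_ ms); apply: eq_measurable_fun => l _ /=.
  by rewrite [RHS]Rintegral_indic_mul.
have : measurable_fun setT (fun l => \int[mu]_x (\1_(`[c, c + eps]%classic : set R) x * - complex.Im (e l x))).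
  apply: (@measurable_Rintegral_snd _ (fun p : R * R => \1_(`[c, c + eps]%classic : set R) p.1 * - complex.Im (e p.2 p.1))).
  by apply: measurable_funM => //; exact: measurableT_comp.
move=> /measurableT_comp /(_ ms); apply: eq_measurable_fun => l _ /=.
by rewrite [RHS]Rintegral_indic_mul.
Qed.

Lemma wave_transform_inL2 k (z : R[i]) (c eps xi : R) : `[c, c + eps]%classic `<=` J k ->
  inL2 sigma setT (fun l => conjc (a k l) * z * itv_transform c eps (l - xi)).
Proof.
move=> EJ; have [vL _] := VP (wave_inL2 alpha beta z c eps xi).
apply: (inL2_ae mT _ vL); last exact: wave_transform.
apply: cmeasurableM; last exact: cmeasurable_itv_transform.
apply: cmeasurableM; last by split; exact: measurable_cst.
by apply: cmeasurable_conj; exact: ma.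
Qed.

Lemma coefficient_sqint N k : sqint sigma setT
  (fun l => \1_(window N) l * (`|complex.Re (a k l)| + `|complex.Im (a k l)|)).
Proof.
have [x Jx] := J_nonempty ab k; have [d d0 Jd] := J_right Jx.
pose q : R := (2 * pi * N.+1%:R)^-1.
have q0 : 0 < q by rewrite invr_gt0 !mulr_gt0// pi_gt0.
(* [d] keeps the interval inside J_k, and [q] keeps the phase at most 1 for all |l| <= N. *)
pose eps := Num.min d q.
have eps0 : 0 < eps by rewrite lt_min d0 q0.
have EJ : `[x, x + eps]%classic `<=` J k.
  move=> y /=; rewrite in_itv/= => /andP[xy yx]; apply: Jd; rewrite xy (le_trans yx)//.
  by rewrite lerD2l ge_min lexx.
have PL := wave_transform_inL2 1 0 EJ.
set P := (fun l => _) in PL.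
have iP := rip_integrable mT PL PL.
pose kappa := (eps * cos 1) ^+ 2.
have kappa0 : 0 < kappa by rewrite exprn_gt0// mulr_gt0// cos1_gt0.
have [m1 m2] := ma k.
have mw : measurable_fun [set: R] (\1_(window N) : R -> R).
  by apply: measurable_indic; exact: measurable_window.
have mab : measurable_fun [set: R] (fun l => \1_(window N) l * (`|complex.Re (a k l)| + `|complex.Im (a k l)|)).
  by apply: measurable_funM => //; apply: measurable_funD; exact: measurableT_comp.
split => //.
(* The 2 comes from (u + v)^2 <= 2 (u^2 + v^2), and [kappa] bounds the squared interval transform
   from below on the window. *)
apply: le_integrable (@integrableZl_EFin _ (measurableTypeR R) R sigma setT mT (2 / kappa) _ iP) => //.
  by apply/measurable_EFinP; exact: measurable_funX.
move=> l _; rewrite lee_fin ger0_norm ?sqr_ge0//; apply: le_trans (ler_norm _).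
have -> : complex.Re (P l) * complex.Re (P l) + complex.Im (P l) * complex.Im (P l) =
    (complex.Re (a k l) ^+ 2 + complex.Im (a k l) ^+ 2) * normc (itv_transform x eps l) ^+ 2.
  rewrite /P subr0 mulr1 normc_sqr; case: (a k l) (itv_transform x eps l) => ? ? [? ?] /=; ring.
rewrite indicE; case: (boolP (l \in _)) => [/set_mem|_]; last first.
  rewrite mul0r expr0n/= mulr_ge0// ?divr_ge0 ?(ltW kappa0)//.
  by rewrite mulr_ge0 ?sqr_ge0// addr_ge0 ?sqr_ge0.
rewrite /= in_itv/= -ler_norml => lN; rewrite mul1r.
have Hk : kappa <= normc (itv_transform x eps l) ^+ 2.
  apply: itv_transform_ge => //.
  apply: (@le_trans _ _ (`|2 * pi * l| * q)).
    by rewrite ler_wpM2l// ge_min lexx orbT.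
  rewrite /q normrM (@gtr0_norm _ (2 * pi)) ?mulr_gt0 ?pi_gt0//.
  rewrite ler_pdivrMr ?mul1r; last by rewrite !mulr_gt0// pi_gt0.
  rewrite ler_pM2l ?mulr_gt0 ?pi_gt0// (le_trans lN)// ler_nat.
  exact: leqnSn.
apply: (@le_trans _ _ (2 / kappa * ((complex.Re (a k l) ^+ 2 + complex.Im (a k l) ^+ 2) * kappa))); last first.
  rewrite ler_wpM2l ?divr_ge0 ?(ltW kappa0)// ler_wpM2l//.
  by rewrite addr_ge0 ?sqr_ge0.
have -> : 2 / kappa * ((complex.Re (a k l) ^+ 2 + complex.Im (a k l) ^+ 2) * kappa) =
    2 * (`|complex.Re (a k l)| ^+ 2 + `|complex.Im (a k l)| ^+ 2).
  by rewrite !real_normK ?num_real//; field; rewrite gt_eqF.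
have := sqr_ge0 (`|complex.Re (a k l)| - `|complex.Im (a k l)|).
by move: `|complex.Re (a k l)| `|complex.Im (a k l)| => u v; nra.
Qed.

Lemma coefficient_bound_sqint N :
  sqint sigma setT (fun l => \1_(window N) l * coefficient_bound a l).
Proof.
rewrite (_ : (fun l => _) = fun l => \sum_k \1_(window N) l * (`|complex.Re (a k l)| + `|complex.Im (a k l)|)).
  elim: (index_enum _) => [|k r ih].
    under eq_fun do rewrite big_nil; split; first exact: measurable_cst.
    have i0 : sigma.-integrable setT (cst 0%E) by exact: integrable0.
    by apply: eq_integrable i0 => // l _ /=; rewrite expr0n.
  under eq_fun do rewrite big_cons.
  by apply: (sqintD mT) => //; exact: coefficient_sqint.
by apply/funext => l; rewrite mulr_sumr.
Qed.

(** * Weak form of the spectral representation, isometry and intertwining *)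

Variable U : R -> (R -> R[i]) -> (R -> R[i]).
Hypothesis UP : spectral_representation alpha beta psi F0 mF U.
Hypothesis U_group : unitary_one_parameter_group alpha beta U.

Let window_truncation M (f : R -> R[i]) x := (\1_(window M) x)%:C%C * f x.

Lemma window_truncation_inL2 M f : inL2 mu Omega f ->
  inL2 mu Omega (window_truncation M f).
Proof.
move=> fL; apply: (@inL2_bounded_mul _ (measurableTypeR R) R mu Omega mO _ 1) => //.
- split; last exact: measurable_cst.
  by apply: measurable_funTS; apply: measurable_indic; exact: measurable_window.
- by move=> x _ /=; rewrite indicE ger0_norm; case: (_ \in _).
- by move=> x _ /=; rewrite normr0.
Qed.

Lemma truncated_transform_truncation M f : TM M (window_truncation M f) = TM M f.
Proof.
apply/funext => l; apply: eq_cintegral => x /set_mem[_ wx].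
by rewrite /window_truncation indicE mem_set// mul1r.
Qed.

(** Square integrability over all frequencies is inherited from V: the function is almost everywhere
    V of the truncation of f. *)
Lemma truncated_transform_inL2 M f : inL2 mu Omega f -> inL2 sigma setT (TM M f).
Proof.
move=> fL; have fML := window_truncation_inL2 M fL.
have [vL _] := VP fML.
apply: (inL2_ae mT (cmeasurable_TM M fL) vL).
rewrite -truncated_transform_truncation; apply: plancherel_compact_support => //.
  by move=> x _ nw; rewrite /window_truncation indicE memNset// mul0r.
exact: VP.
Qed.

Lemma rip_window M f h : rip mu Omega (window_truncation M f) h =
  \int[mu]_(x in Omega `&` window M) complex.Re (conjc (f x) * h x).
Proof.
rewrite [RHS]Rintegral_mkcondr; apply: eq_Rintegral => x _.
rewrite patchE /window_truncation indicE Re_conjcM.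
case: (x \in _); case: (f x) => u v /=.
  by rewrite !(mul0r, mul1r) subr0 addr0.
by rewrite !(mul0r, subr0, addr0).
Qed.

Lemma modulation_inL2 t g : inL2 sigma setT g -> inL2 sigma setT (modulation t g).
Proof.
move=> gL; apply: (@inL2_bounded_mul _ (measurableTypeR R) R sigma setT mT (fun l => e l (- t)) 1) => //.
- exact: measurable_e_snd.
- by move=> l _; exact: Re_e_le1.
- by move=> l _; exact: Im_e_le1.
Qed.

(* The outer truncation (M) makes Fubini's theorem available; the inner one (N) is the
   Plancherel limit. *)
Lemma spectral_weak f1 f t : inL2 mu Omega f1 -> inL2 mu Omega f ->
  rip mu Omega f1 (U t f) = rip sigma setT (V f1) (modulation t (V f)).
Proof.
move=> f1L fL; have [g Pg syn] := UP fL.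
have [gL _] := Pg; have [vL _] := VP fL; have [v1L v1cv] := VP f1L.
(* The representation supplies some Plancherel transform [g] of f; uniqueness identifies it with V f
   almost everywhere. *)
have gV := plancherel_unique fL Pg (VP fL).
have gtL := modulation_inL2 t gL.
have [UL scv] := syn t.
have key M : rip mu Omega (window_truncation M f1) (U t f) =
    rip sigma setT (TM M f1) (modulation t g).
  have TL := truncated_transform_inL2 M f1L.
  have f1ML := window_truncation_inL2 M f1L.
  have c1 := cvgL2_rip mO (fun N => cmeasurable_truncated_synthesis mF
    (measurable_psi_Re ab ma psiE) (measurable_psi_Im ab ma psiE) N (cmeasurable_inL2 gtL)) UL f1ML scv.
  have iTg : sigma.-integrable setT (EFin \o (fun l => complex.Re (conjc (TM M f1 l) * modulation t g l))).
    by apply: eq_integrable (rip_integrable mT TL gtL) => // l _; rewrite /comp Re_conjcM.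
  have c2 := Rintegral_window_cvg mT iTg.
  have c12 : (fun N => rip mu Omega (window_truncation M f1) (truncated_synthesis psi F N (modulation t g))) =
      (fun N => \int[sigma]_(l in setT `&` window N) complex.Re (conjc (TM M f1 l) * modulation t g l)).
    apply/funext => N; rewrite rip_window setTI.
    apply: (kernel_Fubini (G := coefficient_bound a)) => //.
    - exact: (measurable_psi_Re ab ma psiE).
    - exact: (measurable_psi_Im ab ma psiE).
    - exact: (psi_Re_le psiE).
    - exact: (psi_Im_le psiE).
    - exact: coefficient_bound_ge0.
    - exact: coefficient_bound_sqint.
  rewrite -c12 in c2.
  rewrite (cvg_unique (@norm_hausdorff _ _) c1 c2).
  by apply: eq_Rintegral => l _; rewrite Re_conjcM.
have c3 : rip mu Omega (window_truncation M f1) (U t f) @[M --> \oo] --> rip mu Omega f1 (U t f).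
  have iU : mu.-integrable Omega (EFin \o (fun x => complex.Re (conjc (f1 x) * U t f x))).
    by apply: eq_integrable (rip_integrable mO f1L UL) => // x _; rewrite /comp Re_conjcM.
  rewrite (_ : rip mu Omega f1 (U t f) = \int[mu]_(x in Omega) complex.Re (conjc (f1 x) * U t f x)).
    under eq_fun do rewrite rip_window.
    exact: (Rintegral_window_cvg mO iU).
  by apply: eq_Rintegral => x _; rewrite Re_conjcM.
have c4 := cvgL2_rip mT (fun N => cmeasurable_TM N f1L) v1L gtL v1cv.
have c34 : (fun M => rip mu Omega (window_truncation M f1) (U t f)) =
    (fun M => rip sigma setT (modulation t g) (TM M f1)).
  by apply/funext => M; rewrite key ripC.
rewrite -c34 in c4.
rewrite (cvg_unique (@norm_hausdorff _ _) c3 c4) ripC.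
apply: (ae_eq_rip mT) => //.
- exact: cmeasurable_inL2 v1L.
- exact: cmeasurable_inL2 gtL.
- exact: cmeasurable_inL2 (modulation_inL2 t vL).
- by apply: filterS gV => l H lT; rewrite /modulation H.
Qed.

Lemma spectral_isometry f1 f : inL2 mu Omega f1 -> inL2 mu Omega f ->
  rip mu Omega f1 f = rip sigma setT (V f1) (V f).
Proof.
move=> f1L fL; have [UU U0 _ _] := U_group; have [UL _ _ _] := UU 0.
rewrite -[RHS](_ : rip sigma setT (V f1) (modulation 0 (V f)) = _).
  rewrite -spectral_weak//; apply: (ae_eq_rip mO).
  - exact: cmeasurable_inL2 f1L.
  - exact: cmeasurable_inL2 fL.
  - exact: cmeasurable_inL2 (UL _ fL).
  - by apply: ae_eq_sym; exact: U0.
apply: eq_Rintegral => l _.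
have -> // : modulation 0 (V f) l = V f l.
by rewrite /modulation -[e l _]mul1r oppr0 -(conjc_eK l 0) /e mulr0 cos0 sin0 /=
  !(mulr0, oppr0) -[RHS]mul1r; congr (_ * _); apply/eqP; rewrite eq_complex/=; apply/andP; split; apply/eqP; ring.
Qed.

(** Expand the squared norm of V U_t f - M_t V f: each of the four inner products equals the squared
    norm of U_t f, the mixed ones by [spectral_weak]. *)
Lemma spectral_intertwining t f : inL2 mu Omega f ->
  ae_eq sigma setT (V (U t f)) (modulation t (V f)).
Proof.
move=> fL; have [UU _ _ _] := U_group; have [UL _ Uiso _] := UU t.
have utL := UL _ fL; have [vL _] := VP fL; have [vuL _] := VP utL.
have mvL := modulation_inL2 t vL.
apply: (rip_eq0_ae mT vuL mvL).
have dA : rip sigma setT (fun l => V (U t f) l - modulation t (V f) l) (V (U t f)) =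
    rip sigma setT (V (U t f)) (V (U t f)) - rip sigma setT (V (U t f)) (modulation t (V f)).
  by rewrite ripC (ripBr mT vuL vuL mvL).
have dB : rip sigma setT (fun l => V (U t f) l - modulation t (V f) l) (modulation t (V f)) =
    rip sigma setT (V (U t f)) (modulation t (V f)) - rip sigma setT (modulation t (V f)) (modulation t (V f)).
  by rewrite ripC (ripBr mT mvL vuL mvL); congr (_ - _); exact: ripC.
rewrite (ripBr mT (inL2B mT vuL mvL) vuL mvL) dA dB.
rewrite -(spectral_weak t utL fL) -(spectral_isometry utL utL).
have -> : rip sigma setT (modulation t (V f)) (modulation t (V f)) = rip mu Omega (U t f) (U t f).
  rewrite -[RHS](Re_innerL2 mu) Uiso// Re_innerL2 spectral_isometry//.
  apply: eq_Rintegral => l _; rewrite /modulation /e.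
  set x := 2 * pi * l * - t; case: (V f l) => u v /=.
  by rewrite -[RHS]mul1r -(cos2Dsin2 x); ring.
by rewrite !subrr.
Qed.

Lemma leftmost_coefficient_ae_neq0 : {ae mu, forall l, a ord0 l != 0}.
Proof.
have [b Jb] := J_left alpha beta.
have EJ c eps : c + eps < b -> `[c, c + eps]%classic `<=` J ord0.
  by move=> cb x /=; rewrite in_itv/= => /andP[_ xc]; apply: Jb; exact: le_lt_trans cb.
pose I c eps := (`[c, c + eps]%classic : set R).
pose rho c eps s := \int[mu]_x (\1_(I c eps) x * \1_(I (c + s) eps) x : R).
pose w l := normc (a ord0 l) ^+ 2 * F l.
have [m1 m2] := ma ord0.
have mw : measurable_fun [set: R] w.
  apply: measurable_funM => //; under eq_fun do rewrite normc_sqr.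
  by apply: measurable_funD; exact: measurable_funX.
have w0 l : 0 <= w l by rewrite mulr_ge0 ?sqr_ge0// ltW.
pose W z c eps xi l := conjc (a ord0 l) * z * itv_transform c eps (l - xi).
have WL z c eps xi : c + eps < b -> inL2 sigma setT (W z c eps xi).
  by move=> cb; apply: wave_transform_inL2; exact: EJ.
(* Isometry applied to two waves of equal frequency, on I and on I + s. In L^2(Omega) the
   modulations cancel and only the overlap length remains, whatever xi is. *)
have ripW z c eps xi s : 0 < eps -> c + eps < b -> s <= 0 ->
    mu.-integrable setT (EFin \o (fun l => complex.Re (conjc (W 1 c eps xi l) * W z (c + s) eps xi l) * F l)) /\
    \int[mu]_l (complex.Re (conjc (W 1 c eps xi l) * W z (c + s) eps xi l) * F l) =
    complex.Re z * rho c eps s.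
  move=> eps0 cb s0.
  have cb' : c + s + eps < b by lra.
  have iW := rip_integrable mT (WL 1 _ _ xi cb) (WL z _ _ xi cb').
  have iW' : sigma.-integrable setT (EFin \o (fun l => complex.Re (conjc (W 1 c eps xi l) * W z (c + s) eps xi l))).
    by apply: eq_integrable iW => // l _; rewrite /comp Re_conjcM.
  split.
    exact: (iffLR (integrable_density F0 mF (iffLR (measurable_EFinP _ _) (measurable_int _ iW'))) iW').
  rewrite -(Rintegral_density iW').
  transitivity (rip mu Omega (wave 1 c eps xi) (wave z (c + s) eps xi)); last first.
    rewrite /rho -RintegralZl//; last first.
      apply: (@integrable_mul_bounded _ (measurableTypeR R) R mu setT mT _ _ 1).
      - exact: integrable_indic_itv.
      - by apply: measurable_indic; exact: measurable_itv.
      - by move=> x _; rewrite indicE ger0_norm; case: (_ \in _).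
    rewrite /rip [LHS]Rintegral_indic_mul; apply: eq_Rintegral => x _; rewrite /wave /I.
    have -> : \1_(`[c, c + eps]%classic : set R) x = \1_Omega x * \1_(`[c, c + eps]%classic : set R) x :> R.
      rewrite !indicE; case: (boolP (x \in `[c, c + eps]%classic)) => [/set_mem xI|_].
        by rewrite mem_set ?mulr1//; exists ord0 => //; exact: EJ xI.
      by rewrite mulr0.
    have O2 : \1_Omega x * \1_Omega x = \1_Omega x :> R.
      by rewrite indicE; case: (_ \in _); rewrite ?mulr1 ?mulr0.
    move: O2; set o := \1_Omega x; set i1 := \1_(`[c, c + eps]%classic) x; set i2 := \1_(`[c + s, c + s + eps]%classic) x => O2.
    have := cos2Dsin2 (2 * pi * xi * x); rewrite /e.
    set p := cos _; set q := sin _ => pq.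
    case: z {iW iW'} => u v /=; transitivity ((o * o) * i1 * i2 * u * (p ^+ 2 + q ^+ 2)); first ring.
    by rewrite O2 pq; ring.
  rewrite (spectral_isometry (wave_inL2 _ _ _ _ _ _) (wave_inL2 _ _ _ _ _ _)).
  have v1 := wave_transform 1 xi (EJ _ _ cb); have v2 := wave_transform z xi (EJ _ _ cb').
  have [V1 _] := VP (wave_inL2 alpha beta 1 c eps xi).
  have [V2 _] := VP (wave_inL2 alpha beta z (c + s) eps xi).
  have cW1 := cmeasurable_inL2 (WL 1 _ _ xi cb); have cW2 := cmeasurable_inL2 (WL z _ _ xi cb').
  rewrite (ae_eq_rip mT (cmeasurable_inL2 V1) (cmeasurable_inL2 V2) cW2 v2) ripC.
  rewrite (ae_eq_rip mT cW2 (cmeasurable_inL2 V1) cW1 v1) ripC.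
  by apply: eq_Rintegral => l _; rewrite Re_conjcM.
(* The translation by s becomes a character in lambda; z = 1 selects its cosine and z = i its
   sine. *)
have WE z c eps xi s l : complex.Re (conjc (W 1 c eps xi l) * W z (c + s) eps xi l) * F l =
   w l * normc (itv_transform c eps (l - xi)) ^+ 2 * complex.Re (z * conjc (e (l - xi) s)).
  rewrite /W itv_transform_shift /w !normc_sqr.
  case: (a ord0 l) (itv_transform c eps (l - xi)) (e (l - xi) s) z => ? ? [? ?] [? ?] [? ?] /=; ring.
have wne : {ae mu, forall l, w l != 0}.
  apply: (@weight_ae_neq0 _ b w rho) => //.
  - move=> c eps eps0; rewrite /rho addr0.
    rewrite (_ : (fun x => _) = fun x => \1_(I c eps) x * 1 :> R).
      rewrite -[X in 0 < X]Rintegral_indic_mul Rintegral_cst; last exact: mitv.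
      by rewrite /= lebesgue_measure_itv/= lte_fin ltrDl eps0/= mul1r addrC addKr.
    by apply/funext => x; rewrite indicE; case: (_ \in _); rewrite ?mulr1 ?mulr0.
  - move=> c eps xi eps0 cb.
    have [iW _] := ripW 1 c eps xi 0 eps0 cb (lexx 0).
    apply: eq_integrable iW => // l _ /=; congr EFin.
    by rewrite WE /e mulr0 cos0 sin0 /=; ring.
  - move=> c eps xi s eps0 cb s0.
    have [_ W1] := ripW 1 c eps xi s eps0 cb s0.
    rewrite mul1r in W1; rewrite -W1; apply: eq_Rintegral => l _.
    by rewrite WE mul1r Re_conjc.
  - move=> c eps xi s eps0 cb s0.
    have [_ W1] := ripW (Complex 0 1) c eps xi s eps0 cb s0.
    rewrite mul0r in W1; rewrite -[RHS]W1; apply: eq_Rintegral => l _.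
    rewrite WE /e /=; ring.
move: wne; apply: ae_imp => l; apply: contra => /eqP a0.
by rewrite /w a0 normc_sqr /= expr0n/= addr0 mul0r.
Qed.

(** * The adjoint as a two-sided inverse *)

Variable Vs : (R -> R[i]) -> (R -> R[i]).
Hypothesis VsP : adjoint_of alpha beta F0 mF V Vs.

Lemma rip_adjoint f g : inL2 mu Omega f -> inL2 sigma setT g ->
  rip sigma setT (V f) g = rip mu Omega f (Vs g).
Proof. by move=> fL gL; rewrite -!Re_innerL2 VsP.2. Qed.

Lemma adjoint_leftinv f : inL2 mu Omega f -> ae_eq mu Omega (Vs (V f)) f.
Proof.
move=> fL; have [vL _] := VP fL; have vsL := VsP.1 _ vL.
apply: (rip_eq0_ae mO vsL fL).
(* With d = V* V f - f, adjointness and isometry give <d, V* V f> = <V d, V f> = <d, f>, so d is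
   orthogonal to itself. *)
have dL := inL2B mO vsL fL.
by rewrite (ripBr mO dL vsL fL) -(rip_adjoint dL vL) -(spectral_isometry dL fL) subrr.
Qed.

(** By intertwining, M_t V f = V U_t f lies in the range of V, and g - V V* g is orthogonal to that
    range. *)
Lemma transform_orthogonal g f t : inL2 sigma setT g -> inL2 mu Omega f ->
  rip sigma setT (modulation t (V f)) (fun l => g l - V (Vs g) l) = 0.
Proof.
move=> gL fL; have vsL := VsP.1 _ gL; have [vvsL _] := VP vsL.
have [UU _ _ _] := U_group; have [UL _ _ _] := UU t.
have uL := UL _ fL; have [vL _] := VP fL; have [vuL _] := VP uL.
have rL := inL2B mT gL vvsL.
rewrite ripC -(ae_eq_rip mT (cmeasurable_inL2 rL) (cmeasurable_inL2 vuL)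
  (cmeasurable_inL2 (modulation_inL2 t vL)) (spectral_intertwining t fL)) ripC.
by rewrite (ripBr mT vuL gL vvsL) (rip_adjoint uL gL) -(spectral_isometry uL vsL) subrr.
Qed.

Lemma adjoint_rightinv g : inL2 sigma setT g -> ae_eq sigma setT (V (Vs g)) g.
Proof.
move=> gL; have vsL := VsP.1 _ gL; have [vvsL _] := VP vsL.
pose r l := g l - V (Vs g) l.
have rL : inL2 sigma setT r := inL2B mT gL vvsL.
have [b Jb] := J_left alpha beta.
(* The transform of a fixed interval has zeros, so each window gets its own interval, short enough
   for the transform not to vanish there. *)
suff r0 N : {ae mu, forall l, `|l| <= N%:R -> r l = 0}.
  have : {ae sigma, forall l, r l = 0}.
    apply: (iffRL (ae_density F0 mF _)).
    have := @ae_foralln _ (measurableTypeR R) R mu _ r0.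
    apply: ae_imp => l rl; apply: (rl (Num.bound `|l|)).
    by rewrite ltW// archi_boundP.
  by apply: filterS => l rl _; apply/esym/eqP; rewrite -subr_eq0; apply/eqP.
pose eps : R := (2 * pi * N.+1%:R)^-1.
have eps0 : 0 < eps by rewrite invr_gt0 !mulr_gt0// pi_gt0.
pose c := b - 2 * eps.
have EJ : `[c, c + eps]%classic `<=` J ord0.
  by move=> x /=; rewrite in_itv/= => /andP[_ xc]; apply: Jb; rewrite /c in xc; lra.
pose W z l := conjc (a ord0 l) * z * itv_transform c eps (l - 0).
have WL z : inL2 sigma setT (W z) by apply: wave_transform_inL2.
pose q l := conjc (W 1 l) * r l * (F l)%:C%C.
have orth z t : \int[mu]_l complex.Re (conjc z * e l t * q l) = 0.
  have zL := wave_inL2 alpha beta z c eps 0; have [vzL _] := VP zL.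
  have := transform_orthogonal t gL zL; rewrite -/r.
  have mzL := modulation_inL2 t vzL; have mWL := modulation_inL2 t (WL z).
  have vW : ae_eq sigma setT (modulation t (V (wave z c eps 0))) (modulation t (W z)).
    by apply: filterS (wave_transform z 0 EJ) => l H lT; rewrite /modulation (H lT).
  rewrite ripC (ae_eq_rip mT (cmeasurable_inL2 rL) (cmeasurable_inL2 mzL) (cmeasurable_inL2 mWL) vW) ripC.
  rewrite /rip (Rintegral_density (rip_integrable mT mWL rL)) => <-.
  apply: eq_Rintegral => l _; rewrite -Re_conjcM /q /W /modulation.
  have -> : e l t = conjc (e l (- t)).
    by rewrite /e mulrN cosN sinN /= opprK.
  clear zL vzL mzL mWL vW; case: (a ord0 l) (itv_transform c eps (l - 0)) (e l (- t)) (r l) z => ? ? [? ?] [? ?] [? ?] [? ?] /=; ring.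
have jq : sigma.-integrable setT (EFin \o (fun l => complex.Re (conjc (W 1 l) * r l))).
  by apply: eq_integrable (rip_integrable mT (WL 1) rL) => // l _; rewrite /comp Re_conjcM.
have jq' : sigma.-integrable setT (EFin \o (fun l => complex.Im (conjc (W 1 l) * r l))).
  apply: eq_integrable (rip_integrable mT (WL (Complex 0 1)) rL) => // l _; rewrite /comp -Re_conjcM /W.
  congr EFin; case: (a ord0 l) (itv_transform c eps (l - 0)) (r l) => ? ? [? ?] [? ?] /=; ring.
have iq1 : mu.-integrable setT (EFin \o (fun l => complex.Re (q l))).
  have := (iffLR (integrable_density F0 mF (iffLR (measurable_EFinP _ _) (measurable_int _ jq)))) jq.
  apply: eq_integrable => // l _ /=; congr EFin.
  by rewrite /q; case: (conjc (W 1 l) * r l) => ? ? /=; ring.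
have iq2 : mu.-integrable setT (EFin \o (fun l => complex.Im (q l))).
  have := (iffLR (integrable_density F0 mF (iffLR (measurable_EFinP _ _) (measurable_int _ jq')))) jq'.
  apply: eq_integrable => // l _ /=; congr EFin.
  by rewrite /q; case: (conjc (W 1 l) * r l) => ? ? /=; ring.
(* Orthogonality with z = 1 and z = i gives A = C' and C = -A'. Changing t to -t flips the sign of
   the sine integrals A' and C' only, so all four vanish. *)
pose A t := \int[mu]_l (complex.Re (q l) * cos (t * l)).
pose A' t := \int[mu]_l (complex.Re (q l) * sin (t * l)).
pose C t := \int[mu]_l (complex.Im (q l) * cos (t * l)).
pose C' t := \int[mu]_l (complex.Im (q l) * sin (t * l)).
have pi2 : 2 * pi != 0 :> R by rewrite mulf_neq0// gt_eqF// pi_gt0.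
have tE (t l : R) : 2 * pi * l * (t / (2 * pi)) = t * l.
  by move: (2 * pi) pi2 => p p0; field.
have AC' t : A t - C' t = 0.
  rewrite -[RHS](orth 1 (t / (2 * pi))) -RintegralB//.
  - apply: eq_Rintegral => l _; rewrite /e tE.
    by case: (q l) => u v /=; ring.
  - exact: integrable_mul_cos.
  - exact: integrable_mul_sin.
have CA' t : C t + A' t = 0.
  rewrite -[RHS](orth (Complex 0 1) (t / (2 * pi))) -RintegralD//.
  - apply: eq_Rintegral => l _; rewrite /e tE.
    by case: (q l) => u v /=; ring.
  - exact: integrable_mul_cos.
  - exact: integrable_mul_sin.
have AN t : A (- t) = A t by apply: eq_Rintegral => l _; rewrite mulNr cosN.
have CN t : C (- t) = C t by apply: eq_Rintegral => l _; rewrite mulNr cosN.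
have A'N t : A' (- t) = - A' t.
  rewrite -[RHS]mulN1r /A' -RintegralZl//; last exact: integrable_mul_sin.
  by apply: eq_Rintegral => l _; rewrite mulNr sinN; ring.
have C'N t : C' (- t) = - C' t.
  rewrite -[RHS]mulN1r /C' -RintegralZl//; last exact: integrable_mul_sin.
  by apply: eq_Rintegral => l _; rewrite mulNr sinN; ring.
have vq1 : vanishing_transform (fun l => complex.Re (q l)).
  split=> // t; have := AC' t; have := AC' (- t); have := CA' t; have := CA' (- t).
  rewrite AN CN A'N C'N -/(A t) -/(A' t) => *; split; lra.
have vq2 : vanishing_transform (fun l => complex.Im (q l)).
  split=> // t; have := AC' t; have := AC' (- t); have := CA' t; have := CA' (- t).
  rewrite AN CN A'N C'N -/(C t) -/(C' t) => *; split; lra.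
have q0 : {ae mu, forall l, q l = 0}.
  have := vanishing_transform_ae0 vq2; have := vanishing_transform_ae0 vq1.
  by apply: ae_imp2 => l; case: (q l) => ? ? /= -> ->.
move: q0 leftmost_coefficient_ae_neq0; apply: ae_imp2 => l ql a0 lN.
have F0' : (F l)%:C%C != 0 :> R[i].
  by rewrite eq_complex /= eqxx andbT gt_eqF.
have H0 : itv_transform c eps (l - 0) != 0.
  apply/eqP => H0; have : (eps * cos 1) ^+ 2 <= 0 :> R.
    apply: (@le_trans _ _ (normc (itv_transform c eps (l - 0)) ^+ 2)); last first.
      by rewrite H0 normc_sqr /= expr0n/= addr0.
    rewrite subr0; apply: itv_transform_ge => //.
    rewrite /eps normrM (@gtr0_norm _ (2 * pi)) ?mulr_gt0 ?pi_gt0//.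
    rewrite ler_pdivrMr ?mul1r; last by rewrite !mulr_gt0// pi_gt0.
    rewrite ler_pM2l ?mulr_gt0 ?pi_gt0// (le_trans lN)// ler_nat.
    exact: leqnSn.
  by rewrite leNgt exprn_gt0// mulr_gt0// cos1_gt0.
(* The density, the interval transform and the leftmost coefficient are nonzero here, so the
   vanishing factor of q is r. *)
move/eqP: ql; rewrite /q /W !mulf_eq0 (negbTE F0') orbF conjc_eq0 !mulf_eq0.
by rewrite (negbTE H0) conjc_eq0 (negbTE a0) oner_eq0/= => /eqP.
Qed.

End SpectralTransform.

Theorem theorem2p5 (R : realType) (n : nat) (n_gt2 : (2 < n)%N)
    (alpha beta : 'I_n -> R) (alpha_beta : interlaced alpha beta)
    (B : 'M[R[i]]_n) (B_unitary : B \is unitarymx)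
    (B_nondegenerate : ~~ degenerate B)
    (U : R -> (R -> R[i]) -> (R -> R[i]))
    (U_generated : group_generated_by_P alpha beta B U)
    (psi : R -> R -> R[i])
    (psi_eigen : bounded_eigenfunction_system alpha beta B psi)
    (F : R -> R) (F0 : forall lambda, 0 < F lambda)
    (mF : measurable_fun [set: R] F)
    (U_spectral : spectral_representation alpha beta psi F0 mF U)
    (V Vs : (R -> R[i]) -> (R -> R[i]))
    (V_transform : spectral_transform alpha beta psi F0 mF V)
    (Vs_adjoint : adjoint_of alpha beta F0 mF V Vs) :
  [/\ forall g : R -> R[i], inL2 (density_measure F0 mF) [set: R] g ->
        ae_eq (density_measure F0 mF) [set: R] (V (Vs g)) g,
      forall f : R -> R[i], inL2 lebesgue_measure (Omega alpha beta) f ->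
        ae_eq lebesgue_measure (Omega alpha beta) (Vs (V f)) f
    & forall (t : R) (g : R -> R[i]), inL2 (density_measure F0 mF) [set: R] g ->
        ae_eq (density_measure F0 mF) [set: R]
          (V (U t (Vs g))) (modulation t g)].
Proof.
have [a [ma psiE]] := eigenfunction_coefficients alpha_beta psi_eigen.
have [U_group _] := U_generated.
have right := adjoint_rightinv alpha_beta ma psiE V_transform U_spectral U_group Vs_adjoint.
split=> [g gL|f fL|t g gL].
- exact: right.
- exact: (adjoint_leftinv alpha_beta ma psiE V_transform U_spectral U_group Vs_adjoint).
have inter := spectral_intertwining alpha_beta ma psiE V_transform U_spectral U_group t
  (Vs_adjoint.1 _ gL).
apply: ae_eq_trans inter _.
by apply: filterS (right g gL) => l H lT; rewrite /modulation (H lT).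
Qed.
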